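(* Let $C$ be a nonempty closed convex subset of a $2$-uniformly convex and uniformly smooth real Banach space $E$ with dual $E^*$. Let $f_1,f_2:C\times C\to\mathbb{R}$ be bifunctions satisfying (A1)--(A4) (listed in the context), and let $B_1,B_2:C\to E^*$ be continuous monotone mappings. Let $T_j:C\to C$, $j=1,\dots,d$, be a finite family of continuous relatively nonexpansive mappings, and let $A_i:C\to E^*$, $i=1,\dots,m$, be a finite family of $\gamma_i$-inverse strongly monotone operators with constants $\gamma_i\in(0,1)$. Suppose that $$F:=\Big[\bigcap_{j=1}^d F(T_j)\Big]\cap\Big[\bigcap_{i=1}^m A_i^{-1}(0)\Big]\cap\Big[\bigcap_{k=1}^2 GEP(f_k,B_k)\Big]\neq\emptyset .$$ Let $\{x_n\}_{n\ge 0}$ be a sequence defined by $$\left\{\begin{array}{l} x_0\in C_0=C\ \text{chosen arbitrarily},\\ z_n=\Pi_C J^{-1}(Jx_n-\lambda_nA_{n+1}x_n),\\ y_n=J^{-1}(\alpha_nJx_n+(1-\alpha_n)JT_{n+1}z_n);\quad u_n,v_n\in C\ \text{such that}\\ f_1(u_n,y)+\langle B_1y_n,y-u_n\rangle+\frac1{r_n}\langle y-u_n,Ju_n-Jy_n\rangle\ge 0\quad\forall y\in C,\\ f_2(v_n,y)+\langle B_2y_n,y-v_n\rangle+\frac1{r_n}\langle y-v_n,Jv_n-Jy_n\rangle\ge 0\quad\forall y\in C,\\ w_n=J^{-1}(\beta Ju_n+(1-\beta)Jv_n),\\ C_{n+1}=\{z\in C_n:\phi(z,w_n)\le\phi(z,x_n)\},\\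 x_{n+1}=\Pi_{C_{n+1}}(x_0),\quad n\ge 0, \end{array}\right.$$ where $A_n=A_{n(\bmod m)}$ and $T_n=T_{n(\bmod d)}$; $r_n\in[c_1,\infty)$ for all $n$, for some $c_1>0$; $\beta\in(0,1)$; $\alpha_n\in(0,1)$ for all $n$ with $\liminf_{n\to\infty}\alpha_n(1-\alpha_n)>0$; and $\lambda_n\in[a,b]$ for all $n$, for some $0<a<b<\frac{c^2\gamma}{2}$, where $c$ is the $2$-uniform convexity constant of $E$ and $\gamma=\min_{1\le i\le m}\gamma_i$. Then the sequence $\{x_n\}_{n\ge0}$ converges (in norm) to some element of $F$.
   Context: $J:E\to E^*$ is the normalized duality mapping, $\langle x,Jx\rangle=\|x\|^2=\|Jx\|^2$; in the spaces considered it is single valued and bijective with inverse $J^{-1}$. $\langle\cdot,\cdot\rangle$ is the duality pairing between $E$ and $E^*$ (written in either order). $\phi:E\times E\to\mathbb{R}$ is $\phi(x,y)=\|x\|^2-2\langle x,Jy\rangle+\|y\|^2$. For a nonempty closed convex $K\subset E$, the generalized projection $\Pi_K:E\to K$ assigns to $y$ the unique minimizer of $\phi(\cdot,y)$ over $K$. $E$ is $2$-uniformly convex if its modulus of convexity satisfies $\delta_E(\epsilon)\ge \kappa\epsilon^2$ for some $\kappa>0$. The constant $c$ (''$2$-uniformly convex constant of $E$'') is the constant, $0<c<1$, for which $\|x-y\|\le\frac{2}{c^2}\|Jx-Jy\|$ for all $x,y\in E$. A mapping $A:C\to E^*$ is monotone if $\langle x-y,Ax-Ay\rangle\ge0$ for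 all $x,y\in C$, and $\gamma$-inverse strongly monotone ($\gamma>0$) if $\langle x-y,Ax-Ay\rangle\ge\gamma\|Ax-Ay\|^2$ for all $x,y\in C$. $A^{-1}(0)=\{x\in C:Ax=0\}$. $F(T)$ is the set of fixed points of $T:C\to C$. A point $p\in C$ is an asymptotic fixed point of $T$ if some sequence $\{x_n\}$ in $C$ converges weakly to $p$ with $\|x_n-Tx_n\|\to0$; $\tilde F(T)$ is the set of these. $T$ is relatively nonexpansive if $F(T)\ne\emptyset$, $\phi(p,Tx)\le\phi(p,x)$ for all $x\in C$, $p\in F(T)$, and $F(T)=\tilde F(T)$. Conditions on a bifunction $f:C\times C\to\mathbb{R}$: (A1) $f(x,x)=0$ for all $x\in C$; (A2) $f(x,y)+f(y,x)\le0$ for all $x,y\in C$; (A3) for all $x,y,z\in C$, $\lim_{t\to0}f(tz+(1-t)x,y)\le f(x,y)$ ($t\in(0,1]$); (A4) for each $x\in C$, $y\mapsto f(x,y)$ is convex and lower semicontinuous. $GEP(f,B)=\{u\in C:f(u,v)+\langle Bu,v-u\rangle\ge0\ \forall v\in C\}$. Indices modulo $m$ (resp. $d$) take values in $\{1,\dots,m\}$ (resp. $\{1,\dots,d\}$), so the finite families are used cyclically.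
   Formalization: In the two equilibrium inequalities B_1 y_n and B_2 y_n are replaced by B_1 u_n and B_2 v_n: y_n need not lie in C, and as printed the claim fails (E=C=R^2, f_k=0, T=id, A=0, B_1, B_2 rotations by ±90°, r_n=1, β=1/2 give x_n=x_0 while F={0}). *)

(* Defs.v *)
From HB Require Import structures.
From mathcomp Require Import all_boot all_order all_algebra.
From mathcomp Require Import all_classical all_reals all_analysis.

Set Implicit Arguments.
Unset Strict Implicit.
Unset Printing Implicit Defensive.

Import Order.TTheory GRing.Theory Num.Theory.
Import numFieldNormedType.Exports.

Local Open Scope classical_set_scope.
Local Open Scope ring_scope.

(* The dual E^* : continuous linear functionals on E, normed by
   |f| = sup {|f x| : |x| <= 1}.  The pairing <x, f> is the application f x. *)

Section TopDual.
Context {R : realType} (E : normedModType R).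

Definition continuous_functional : {pred (E -> R^o)} :=
  mem [set f : E -> R^o | linear f /\ continuous f].

Record top_dual := TopDual {
  functional :> E -> R^o;
  functionalP : functional \in continuous_functional }.

HB.instance Definition _ := [isSub for functional].
HB.instance Definition _ := [Choice of top_dual by <:].

Lemma continuous_functional_submod : subsemimod_closed continuous_functional.
Proof.
split; first split.
- by rewrite inE; split=> [a x y|]; [rewrite /= scaler0 addr0|exact: cst_continuous].
- move=> f g; rewrite !inE => -[lf cf] [lg cg]; split=> [a x y|x].
    by rewrite /= !fctE lf lg scalerDr addrACA.
  exact: cvgD (cf x) (cg x).
- move=> a f; rewrite !inE => -[lf cf]; split=> [b x y|x].
    by rewrite /= !fctE lf scalerDr !scalerA mulrC.
  exact: cvgZr (cf x).
Qed.

HB.instance Definition _ := GRing.isSubmodClosed.Build _ _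
  continuous_functional continuous_functional_submod.
HB.instance Definition _ := [SubChoice_isSubLmodule of top_dual by <:].

Lemma functional_linear (f : top_dual) : linear f.
Proof. by have := functionalP f; rewrite inE => -[]. Qed.

Lemma functional_continuous (f : top_dual) : continuous f.
Proof. by have := functionalP f; rewrite inE => -[]. Qed.

HB.instance Definition _ (f : top_dual) :=
  GRing.isLinear.Build R E R^o *:%R f (functional_linear f).

Definition dual_norm (f : top_dual) : R :=
  sup [set `|f x| | x in [set x | `|x| <= 1]].

Lemma dual_norm_has_sup (f : top_dual) :
  has_sup [set `|f x| | x in [set x | `|x| <= 1]].
Proof.
split; first by exists `|f 0|, 0 => //=; rewrite normr0.
have /bounded_funP/(_ 1)[M HM] :=
  continuous_linear_bounded 0 (@functional_continuous f 0).
by exists M => _ [x /= x1 <-]; exact: HM.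
Qed.

Lemma dual_norm_ub (f : top_dual) x : `|x| <= 1 -> `|f x| <= dual_norm f.
Proof. by move=> x1; apply: (sup_upper_bound (dual_norm_has_sup f)); exists x. Qed.

Lemma dual_norm_lub (f : top_dual) M :
  (forall x, `|x| <= 1 -> `|f x| <= M) -> dual_norm f <= M.
Proof.
move=> fM; apply: ge_sup; first by case: (dual_norm_has_sup f).
by move=> _ [x /= x1 <-]; exact: fM.
Qed.

Lemma dual_normD f g : dual_norm (f + g) <= dual_norm f + dual_norm g.
Proof.
apply: dual_norm_lub => x x1; rewrite (le_trans (ler_normD (f x) (g x)))//.
by rewrite lerD// dual_norm_ub.
Qed.

Lemma dual_normZ_le a f : dual_norm (a *: f) <= `|a| * dual_norm f.
Proof.
by apply: dual_norm_lub => x x1; rewrite [leLHS]normrM ler_wpM2l// dual_norm_ub.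
Qed.

Lemma dual_normZ a f : dual_norm (a *: f) = `|a| * dual_norm f.
Proof.
apply/eqP; rewrite eq_le dual_normZ_le/=.
have [->|a0] := eqVneq a 0.
  rewrite normr0 mul0r (le_trans _ (@dual_norm_ub _ 0 _))//.
  by rewrite normr0.
rewrite -ler_pdivlMl ?normr_gt0// -normfV.
by rewrite -[in leLHS](scalerK a0 f) dual_normZ_le.
Qed.

Lemma dual_norm0_eq0 f : dual_norm f = 0 -> f = 0.
Proof.
move=> f0; apply/val_inj/funext => x /=.
have [->|x0] := eqVneq x 0; first exact: linear0.
have: `|f (`|x|^-1 *: x)| <= 0.
  by rewrite -f0 dual_norm_ub// normrZ normfV normr_id mulVf// normr_eq0.
rewrite normr_le0 linearZ/= scaler_eq0 invr_eq0 normr_eq0 (negbTE x0)/=.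
by move/eqP.
Qed.

HB.instance Definition _ := Lmodule_isNormed.Build R top_dual
  dual_normD dual_normZ dual_norm0_eq0.

End TopDual.

Section Geometry.
Context {R : realType} (E : completeNormedModType R).

(* Valued in \bar R so that the infimum over an empty set (possible when E is
   trivial) is +oo. *)
Definition convexity_modulus (eps : R) : \bar R :=
  ereal_inf [set d | exists x y : E,
    [/\ `|x| = 1, `|y| = 1, eps <= `|x - y|
      & d = (1 - `|2^-1 *: (x + y)|)%:E]].

Definition two_uniformly_convex :=
  exists2 kappa : R, 0 < kappa &
    forall eps : R, 0 < eps <= 2 ->
      ((kappa * eps ^+ 2)%:E <= convexity_modulus eps)%E.

Definition smoothness_modulus (tau : R) : R :=
  sup [set s | exists x y : E,
    [/\ `|x| = 1, `|y| = tau & s = (`|x + y| + `|x - y|) / 2 - 1]].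

Definition uniformly_smooth :=
  smoothness_modulus tau / tau @[tau --> 0^'+] --> (0 : R).

(* In a smooth reflexive strictly convex space the sets below are singletons,
   so J, J^-1 and the generalized projection do not depend on the default
   value 0 of xget. *)
Definition duality_map (x : E) : top_dual E :=
  xget 0 [set f : top_dual E | f x = `|x| ^+ 2 /\ `|f| ^+ 2 = `|x| ^+ 2].

Definition duality_inv (f : top_dual E) : E :=
  xget 0 [set x | duality_map x = f].

Definition phi (x y : E) : R :=
  `|x| ^+ 2 - 2 * duality_map y x + `|y| ^+ 2.

Definition gproj (K : set E) (y : E) : E :=
  xget 0 [set z | K z /\ forall k, K k -> phi z y <= phi k y].

Definition two_uc_constant (c : R) :=
  0 < c < 1 /\
  forall x y : E, `|x - y| <= 2 / c ^+ 2 * `|duality_map x - duality_map y|.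

(* Mappings defined on C are represented by total functions on E; only their
   values on C are ever constrained or used. *)
Section OnSubset.
Variable C : set E.

Definition monotone_on (A : E -> top_dual E) :=
  forall x y, C x -> C y -> 0 <= (A x - A y) (x - y).

Definition inverse_strongly_monotone_on (gamma : R) (A : E -> top_dual E) :=
  forall x y, C x -> C y -> gamma * `|A x - A y| ^+ 2 <= (A x - A y) (x - y).

Definition zeros_on (A : E -> top_dual E) : set E := [set x | C x /\ A x = 0].

Definition fixed_points_on (T : E -> E) : set E := [set x | C x /\ T x = x].

Definition weakly_converges (x : nat -> E) (p : E) :=
  forall g : top_dual E, g (x n) @[n --> \oo] --> g p.

Definition asymptotic_fixed_points_on (T : E -> E) : set E :=
  [set p | C p /\ exists x : nat -> E,
    [/\ forall n, C (x n), weakly_converges x p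
      & `|x n - T (x n)| @[n --> \oo] --> (0 : R)]].

Definition relatively_nonexpansive_on (T : E -> E) :=
  [/\ fixed_points_on T !=set0,
      forall x p, C x -> fixed_points_on T p -> phi p (T x) <= phi p x
    & fixed_points_on T = asymptotic_fixed_points_on T].

Definition lower_semicontinuous_on (g : E -> R) :=
  forall x a, C x -> a < g x -> \forall y \near within C (nbhs x), a < g y.

(* In the third condition the limit is required to exist in \bar R, hence may
   be -oo. *)
Definition equilibrium_bifunction_on (f : E -> E -> R) :=
  [/\ forall x, C x -> f x x = 0,
      forall x y, C x -> C y -> f x y + f y x <= 0,
      forall x y z, C x -> C y -> C z -> exists l : \bar R,
        (f (t *: z + (1 - t) *: x) y)%:E @[t --> 0^'+] --> l /\
        (l <= (f x y)%:E)%E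
    & forall x, C x -> convex_function C (f x) /\ lower_semicontinuous_on (f x)].

Definition GEP (f : E -> E -> R) (B : E -> top_dual E) : set E :=
  [set u | C u /\ forall v, C v -> 0 <= f u v + B u (v - u)].

End OnSubset.

End Geometry.

(* For a family indexed by 'I_m standing for indices 1, ..., m, the position
   of the 1-based index n (n > 0) reduced modulo m into {1, ..., m}. *)
Definition cyclic (m : nat) (m_gt0 : (0 < m)%N) (n : nat) : 'I_m :=
  Ordinal (ltn_pmod n.-1 m_gt0).

(* Main.v *)
Require Import Defs.
From mathcomp Require Import all_boot all_order all_algebra.
From mathcomp Require Import all_classical all_reals all_analysis.
From mathcomp Require Import ring lra.
Import Order.TTheory GRing.Theory Num.Theory.
Import numFieldNormedType.Exports.
Local Open Scope classical_set_scope.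
Local Open Scope ring_scope.

(* Every q in F satisfies
     phi q (w n) + beta phi (u n) (y n) + (1 - beta) phi (v n) (y n)
       + (1 - alpha n) kappa |A x_n|^2 <= phi q (x n)
   with kappa = 2 a (gamma - 2 b / c^2) > 0, so that F lies in each of the
   closed convex sets C_ n.  Since phi s t >= k |s - t|^2 by 2-uniform
   convexity and phi (x n) (x 0) is increasing and bounded, x is Cauchy; let p
   be its limit.  The points x (n+1) of C_ n.+1 force w n --> p, hence
   phi q (x n) - phi q (w n) --> 0 and all the nonnegative terms above vanish.
   Convexity of phi in J of its second argument then turns |u n - v n| --> 0 into
   u n, v n, y n --> p, and norm continuity of J gives z n, T z_n --> p.
   Strong convergence makes the asymptotic fixed points unnecessary: p is a
   common fixed point and zero by continuity along arithmetic progressions of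
   indices, and a generalized equilibrium point by Minty's argument. *)

(** * Quantitative convexity and smoothness of the norm *)

Section NormGeometry.
Set Implicit Arguments.
Unset Strict Implicit.
Context {R : realType} {E : completeNormedModType R}.
Implicit Types (x y h p : E) (f g : top_dual E).

Lemma convexity_modulus_sphere (kappa : R) : 0 < kappa ->
  (forall eps : R, 0 < eps <= 2 ->
    ((kappa * eps ^+ 2)%:E <= convexity_modulus E eps)%E) ->
  forall x y, `|x| = 1 -> `|y| = 1 ->
  `|x + y| <= 2 - 2 * kappa * `|x - y| ^+ 2.
Proof.
move=> k0 Hk x y x1 y1; have [xy|xy] := eqVneq (x - y) 0.
  by rewrite xy normr0 expr0n mulr0 subr0 (le_trans (ler_normD _ _))// x1 y1.
have e0 : 0 < `|x - y| <= 2.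
  by rewrite normr_gt0 xy (le_trans (ler_normB _ _))// x1 y1.
have : (convexity_modulus E `|x - y|%R <= (1 - `|2^-1 *: (x + y)|)%R%:E)%E.
  by apply: ereal_inf_lbound; exists x, y.
move/(le_trans (Hk _ e0)); rewrite lee_fin normrZ ger0_norm ?invr_ge0//; lra.
Qed.

(** Take [|y| <= |x|] and peel off the excess length: [x + y] and [x - y] equal [(|x| - |y|) x']
    plus [|y|] times the sum or difference of the unit vectors [x'], [y']. The sphere estimate then
    controls the second piece. *)
Lemma two_uniformly_convex_sq : two_uniformly_convex E ->
  exists2 k : R, 0 < k & forall x y,
    k * `|x - y| ^+ 2 <= 2 * `|x| ^+ 2 + 2 * `|y| ^+ 2 - `|x + y| ^+ 2.
Proof.
move=> [kappa k0 /(convexity_modulus_sphere k0) Hk].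
(* With [a = |x|], [s = |y|], [e = |x' - y'|], the right-hand side is at least
   [(a - s)^2 + 2 kappa (s e)^2] and [|x - y|^2] at most [2 (a - s)^2 + 2 (s e)^2]. The bound [2^-1]
   serves the first square, [kappa] the second. *)
pose k := Num.min (2^-1) kappa.
have kgt0 : 0 < k by rewrite lt_min k0 invr_gt0 ltr0n.
have k_half : k <= 2^-1 by rewrite ge_min lexx.
have k_kappa : k <= kappa by rewrite ge_min lexx orbT.
exists k => // x y; wlog yx : x y / `|y| <= `|x|.
  move=> H; have [/H//|/ltW/H] := leP `|y| `|x|.
  by rewrite distrC (addrC y) (addrC (2 * `|y| ^+ 2)).
have [->|y0] := eqVneq y 0.
  rewrite subr0 addr0 normr0 expr0n mulr0 addr0.
  by have := sqr_ge0 `|x|; nra.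
have s0 : 0 < `|y| by rewrite normr_gt0.
have a0 : 0 < `|x| by apply: lt_le_trans yx.
pose x' := `|x|^-1 *: x; pose y' := `|y|^-1 *: y.
have x'1 : `|x'| = 1 by rewrite normrZ normfV normr_id mulVf ?gt_eqF.
have y'1 : `|y'| = 1 by rewrite normrZ normfV normr_id mulVf ?gt_eqF.
have xE : x = `|x| *: x' by rewrite scalerA mulfV ?scale1r ?gt_eqF.
have yE : y = `|y| *: y' by rewrite scalerA mulfV ?scale1r ?gt_eqF.
clearbody x' y'; have := Hk _ _ x'1 y'1.
have Ns : `|x + y| <= (`|x| - `|y|) + `|y| * `|x' + y'|.
  have -> : x + y = (`|x| - `|y|) *: x' + `|y| *: (x' + y').
    by rewrite scalerDr addrA -scalerDl subrK -xE -yE.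
  rewrite (le_trans (ler_normD _ _))// !normrZ x'1 mulr1 normr_id lerD2r.
  by rewrite ger0_norm// subr_ge0.
have Ds : `|x - y| <= (`|x| - `|y|) + `|y| * `|x' - y'|.
  have -> : x - y = (`|x| - `|y|) *: x' + `|y| *: (x' - y').
    by rewrite scalerBr addrA -scalerDl subrK -xE -yE.
  rewrite (le_trans (ler_normD _ _))// !normrZ x'1 mulr1 normr_id lerD2r.
  by rewrite ger0_norm// subr_ge0.
have Nt : `|x + y| <= `|x| + `|y| := ler_normD _ _.
have N0 := normr_ge0 (x + y); have D0 := normr_ge0 (x - y).
have M0 := normr_ge0 (x' + y'); have e0 := normr_ge0 (x' - y').
move: Ns Ds Nt N0 D0 M0 e0.
set N := `|x + y|; set D := `|x - y|; set M := `|x' + y'|; set e := `|x' - y'|.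
move: yx s0 a0; set a := `|x|; set s := `|y| => yx s0 a0.
move=> Ns Ds Nt N0 D0 M0 e0 HM.
have N1 : N <= a + s - 2 * kappa * (s * e ^+ 2).
  have := ler_wpM2l (ltW s0) HM; lra.
have q0 : 0 <= kappa * (s * e ^+ 2).
  by rewrite mulr_ge0 ?(ltW k0)// mulr_ge0 ?(ltW s0)// sqr_ge0.
have N2 : N ^+ 2 <= (a + s) ^+ 2 - 2 * kappa * (s * e) ^+ 2.
  have h1 : N ^+ 2 <= (a + s) * N by rewrite expr2 ler_wpM2r.
  have as0 : 0 <= a + s by lra.
  have h2 := ler_wpM2l as0 N1.
  have h3 : s * (kappa * (s * e ^+ 2)) <= (a + s) * (kappa * (s * e ^+ 2)).
    by rewrite ler_wpM2r//; lra.
  move: h1 h2 h3; lra.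
have D2 : D ^+ 2 <= 2 * (a - s) ^+ 2 + 2 * (s * e) ^+ 2.
  have se0 : 0 <= s * e by rewrite mulr_ge0// ltW.
  have : D ^+ 2 <= ((a - s) + s * e) ^+ 2 by rewrite lerXn2r// nnegrE//; lra.
  have := sqr_ge0 ((a - s) - s * e); lra.
have h1 := ler_wpM2l (ltW kgt0) D2.
have h2 := ler_wpM2r (sqr_ge0 (a - s)) k_half.
have h3 := ler_wpM2r (sqr_ge0 (s * e)) k_kappa.
move: N2 h1 h2 h3; set se := (s * e) ^+ 2; lra.
Qed.

(** A [sup] dominates its elements only if the set is bounded; the triangle inequality bounds this
    one by [t]. *)
Lemma smoothness_modulus_ub x y (t : R) : `|x| = 1 -> `|y| = t ->
  (`|x + y| + `|x - y|) / 2 - 1 <= smoothness_modulus E t.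
Proof.
move=> x1 yt; apply: sup_upper_bound; last by exists x, y.
split; first by exists ((`|x + y| + `|x - y|) / 2 - 1), x, y.
exists t => _ [x' [y' [x'1 y't ->]]].
have := ler_normD x' y'; have := ler_normB x' y'; rewrite x'1 y't; lra.
Qed.

(** The symmetric second difference of [|.|^2] at [p] is [o(|h|)]. After scaling [p] to norm 1, with
    [A], [B] the two norms and [s = (A + B)/2 - 1], one has [A^2 + B^2 - 2 = 4 s + 2 s^2 + (A -
    B)^2/2]; smoothness bounds [s], and [|A - B| <= 2 t]. *)
Lemma uniformly_smooth_sq : uniformly_smooth E ->
  forall p (e : R), 0 < e -> exists2 d : R, 0 < d & forall h, `|h| < d ->
    `|p + h| ^+ 2 + `|p - h| ^+ 2 - 2 * `|p| ^+ 2 <= e * `|h|.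
Proof.
move=> smE p e e0; have [->|p0] := eqVneq p 0.
  exists (e / 2); first by rewrite divr_gt0.
  move=> h; rewrite add0r sub0r normrN normr0 expr0n mulr0 subr0.
  have := normr_ge0 h; nra.
have a0 : 0 < `|p| by rewrite normr_gt0.
(* The final error is [|h| (4 e1 |p| + 4 |h|)]; this choice and [|h| < e/16] make each term in the
   bracket at most [e/4]. The cap 1 gives [(e1 t)^2 <= t^2]. *)
pose e1 : R := Num.min 1 (e / (16 * `|p|)).
have e10 : 0 < e1 by rewrite lt_min ltr01/= divr_gt0// mulr_gt0.
have e11 : e1 <= 1 by rewrite ge_min lexx.
have e1p : 4 * e1 * `|p| <= e / 4.
  have : e1 <= e / (16 * `|p|) by rewrite ge_min lexx orbT.
  rewrite ler_pdivlMr ?mulr_gt0//; lra.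
have [d d0 Hd] : exists2 d : R, 0 < d &
    forall t : R, 0 < t < d -> smoothness_modulus E t <= e1 * t.
  have /cvgrPdist_le/(_ e1 e10) := smE.
  rewrite near_withinE; move/nbhs_ballP => [d/= d0 Hd].
  exists d => // t /andP[t0 td].
  have := Hd t; rewrite /ball/= sub0r normrN gtr0_norm// => /(_ td t0).
  rewrite sub0r normrN => /(le_trans (ler_norm _)).
  by rewrite ler_pdivrMr.
exists (Num.min (`|p| * d) (e / 16)).
  by rewrite lt_min mulr_gt0//= divr_gt0.
move=> h; rewrite lt_min => /andP[hd he].
have [->|h0] := eqVneq h 0; first by rewrite addr0 subr0 normr0 mulr0; lra.
pose t := `|h| / `|p|.
have t0 : 0 < t by rewrite divr_gt0// normr_gt0.
have td : t < d by rewrite ltr_pdivrMr// mulrC.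
have hE : `|h| = `|p| * t by rewrite mulrC divfK ?gt_eqF.
pose p' := `|p|^-1 *: p; pose h' := `|p|^-1 *: h.
have p'1 : `|p'| = 1 by rewrite normrZ normfV normr_id mulVf ?gt_eqF.
have h't : `|h'| = t by rewrite normrZ normfV normr_id mulrC.
have pE : p = `|p| *: p' by rewrite scalerA mulfV ?scale1r ?gt_eqF.
have h'E : h = `|p| *: h' by rewrite scalerA mulfV ?scale1r ?gt_eqF.
clearbody p' h'.
have -> : `|p + h| = `|p| * `|p' + h'|.
  by rewrite {1}pE {1}h'E -scalerDr normrZ normr_id.
have -> : `|p - h| = `|p| * `|p' - h'|.
  by rewrite {1}pE {1}h'E -scalerBr normrZ normr_id.
have t0d : 0 < t < d by rewrite t0 td.
have := le_trans (smoothness_modulus_ub p'1 h't) (Hd _ t0d).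
have := ler_normD p' h'; have := ler_normB p' h'.
have : 2 <= `|p' + h'| + `|p' - h'|.
  rewrite (le_trans _ (ler_normD _ _))// addrACA subrr addr0 -mulr2n normrMn.
  by rewrite p'1.
have : `|p' + h'| - `|p' - h'| <= 2 * t.
  have -> : p' + h' = (p' - h') + h' *+ 2 by rewrite mulr2n addrA subrK.
  have := ler_normD (p' - h') (h' *+ 2); rewrite normrMn h't; lra.
have : `|p' - h'| - `|p' + h'| <= 2 * t.
  have -> : p' - h' = (p' + h') - h' *+ 2 by rewrite mulr2n opprD addrA addrK.
  have := ler_normB (p' + h') (h' *+ 2); rewrite normrMn h't; lra.
rewrite hE; rewrite hE in he.
move: a0 e1p he; set a := `|p|; set A := `|p' + h'|; set B := `|p' - h'|.
move=> a0 e1p he ba ab AB2 _ _ rho.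
have [s sE] : exists s, s = (A + B) / 2 - 1 by eexists.
have s0 : 0 <= s by rewrite sE; lra.
have s1 : s <= e1 * t by rewrite sE; lra.
have d2 : (A - B) ^+ 2 <= 4 * t ^+ 2.
  have : 0 <= (2 * t - (A - B)) * (2 * t - (B - A)).
    by rewrite mulr_ge0// subr_ge0.
  lra.
have key : A ^+ 2 + B ^+ 2 - 2 <= t * (4 * e1 + 4 * t).
  have -> : A ^+ 2 + B ^+ 2 - 2 = 4 * s + 2 * s ^+ 2 + (A - B) ^+ 2 / 2.
    by rewrite sE; field.
  have : s ^+ 2 <= (e1 * t) ^+ 2 by rewrite lerXn2r ?nnegrE// mulr_ge0// ltW.
  have : (e1 * t) ^+ 2 <= t ^+ 2.
    by rewrite lerXn2r ?ler_piMl ?nnegrE// ltW// mulr_gt0.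
  move: s1 d2; lra.
have := ler_wpM2l (sqr_ge0 a) key.
have : (a * t) * (4 * e1 * a + 4 * (a * t)) <= (a * t) * (e / 4 + e / 4).
  by apply: ler_wpM2l; [rewrite ltW// mulr_gt0|lra].
have : 0 <= e * (a * t) by rewrite ltW// mulr_gt0// mulr_gt0.
rewrite !exprMn; lra.
Qed.

End NormGeometry.

(** * Dual pairing, and duality elements as subgradients of half the squared norm *)

Section DualityMap.
Set Implicit Arguments.
Unset Strict Implicit.
Context {R : realType} {E : completeNormedModType R}.
Implicit Types (x y h p : E) (f g : top_dual E).

Lemma dual_addE f g x : (f + g) x = f x + g x.
Proof. by []. Qed.

Lemma dual_subE f g x : (f - g) x = f x - g x.
Proof. by []. Qed.

Lemma dual_oppE f x : (- f) x = - f x.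
Proof. by []. Qed.

Lemma dual_scaleE (a : R) f x : (a *: f) x = a * f x.
Proof. by []. Qed.

Lemma dualZ f (a : R) x : f (a *: x) = a * f x.
Proof. exact: linearZ. Qed.

Lemma dualN f x : f (- x) = - f x.
Proof. exact: linearN. Qed.

Lemma dualD f x y : f (x + y) = f x + f y.
Proof. exact: linearD. Qed.

Lemma dualB f x y : f (x - y) = f x - f y.
Proof. exact: linearB. Qed.

Lemma dual_apply_le f x : f x <= `|f| * `|x|.
Proof.
have [->|x0] := eqVneq x 0; first by rewrite linear0 normr0 mulr0.
have x_gt0 : 0 < `|x| by rewrite normr_gt0.
have := @dual_norm_ub _ _ f (`|x|^-1 *: x).
rewrite normrZ normfV normr_id mulVf ?gt_eqF// => /(_ (lexx _)).
move=> /(le_trans (ler_norm _)); rewrite linearZ/=.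
by rewrite -(ler_pM2l x_gt0) [X in X <= _]mulVKf ?gt_eqF// mulrC.
Qed.

Lemma norm_dual_apply_le f x : `|f x : R| <= `|f| * `|x|.
Proof.
by rewrite ler_norml dual_apply_le andbT lerNl -dualN -(normrN x) dual_apply_le.
Qed.

Lemma dual_norm_le f (M : R) :
  (forall h, `|h| <= 1 -> f h <= M) -> `|f| <= M.
Proof.
move=> fM; apply: dual_norm_lub => h h1; rewrite ler_norml fM// andbT.
by rewrite lerNl -linearN fM// normrN.
Qed.

Lemma norm_sq_convex (V : normedModType R) (v w : V) (t : R) : 0 <= t <= 1 ->
  `|t *: v + (1 - t) *: w| ^+ 2 <= t * `|v| ^+ 2 + (1 - t) * `|w| ^+ 2.
Proof.
move=> /andP[t0 t1]; have s0 : 0 <= 1 - t by rewrite subr_ge0.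
have := ler_normD (t *: v) ((1 - t) *: w).
rewrite !normrZ (ger0_norm t0) (ger0_norm s0).
move: (normr_ge0 v) (normr_ge0 w) (normr_ge0 (t *: v + (1 - t) *: w)).
set a := `|v|; set b := `|w|; set c := `|_| => a0 b0 c0 cab.
have : c ^+ 2 <= (t * a + (1 - t) * b) ^+ 2.
  by rewrite lerXn2r// nnegrE addr_ge0// mulr_ge0.
have : 0 <= (t * (1 - t)) * (a - b) ^+ 2 by rewrite mulr_ge0 ?sqr_ge0// mulr_ge0.
lra.
Qed.

(* Membership in the possibly multivalued duality mapping. *)
Definition is_dual x f := f x = `|x| ^+ 2 /\ `|f| ^+ 2 = `|x| ^+ 2.

(** From [2 f(x + h) <= 2 |f| |x + h| <= |f|^2 + |x + h|^2]. *)
Lemma is_dual_subgradient x f :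
  is_dual x f -> forall h, 2 * f h <= `|x + h| ^+ 2 - `|x| ^+ 2.
Proof.
move=> [fx nf] h; have := dual_apply_le f (x + h).
rewrite linearD/= fx => fxh; have := sqr_ge0 (`|f| - `|x + h|).
move: fxh nf; set F := `|f|; set a := `|x|; set b := `|x + h|.
set c : R := f h; move=> fxh nf; rewrite sqrrB nf; lra.
Qed.

Lemma le_of_eps (a b : R) : (forall e : R, 0 < e -> a <= b + e) -> a <= b.
Proof. by move=> H; apply/ler_addgt0Pr => e; exact: H. Qed.

Lemma le_of_small (a b c : R) :
  (forall t : R, 0 < t <= 1 -> a <= b + t * c) -> a <= b.
Proof.
move=> H; apply: le_of_eps => e e0.
have c1 : 0 < `|c| + 1 by rewrite ltr_wpDl.
pose t := Num.min 1 (e / (`|c| + 1)).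
have t0 : 0 < t by rewrite lt_min ltr01 divr_gt0.
have t1 : t <= 1 by rewrite ge_min lexx.
have te : t * (`|c| + 1) <= e by rewrite -ler_pdivlMr// ge_min lexx orbT.
have := H t; rewrite t0 t1 => /(_ isT) /le_trans; apply; rewrite lerD2l.
rewrite (le_trans _ te)// ler_pM2l// (le_trans (ler_norm _))//.
by rewrite lerDl.
Qed.

(** Directions [t x] and [- t x] with small [t] force [f x = |x|^2]. Small multiples of unit vectors
    give [|f| <= |x|], and [|x|^2 = f x <= |f| |x|] gives the reverse. *)
Lemma subgradient_is_dual x f :
  (forall h, 2 * f h <= `|x + h| ^+ 2 - `|x| ^+ 2) -> is_dual x f.
Proof.
move=> H; have Ht (t : R) h : t * (2 * f h) <= `|x + t *: h| ^+ 2 - `|x| ^+ 2.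
  by rewrite mulrCA; have := H (t *: h); rewrite linearZ.
have Hx (t : R) : -1 <= t -> t * (2 * f x) <= t * (2 * `|x| ^+ 2 + t * `|x| ^+ 2).
  move=> t1; apply: (le_trans (Ht t x)).
  rewrite -{1}(scale1r x) -scalerDl normrZ ger0_norm ?exprMn; last lra.
  by rewrite le_eqVlt; apply/orP; left; apply/eqP; ring.
have fx : f x = `|x| ^+ 2.
  apply/eqP; rewrite eq_le; apply/andP; split.
    apply: (@le_of_small _ _ (`|x| ^+ 2 / 2)) => t /andP[t0 t1].
    by have := Hx t; rewrite ler_pM2l// => /(_ ltac:(lra)); lra.
  apply: (@le_of_small _ _ (`|x| ^+ 2 / 2)) => t /andP[t0 t1].
  have := Hx (- t) ltac:(lra); rewrite !mulNr lerN2 ler_pM2l//; lra.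
split=> //.
have fle : `|f| <= `|x|.
  apply: dual_norm_le => h h1; apply: (@le_of_small _ _ 2^-1) => t /andP[t0 t1].
  have : `|x + t *: h| ^+ 2 <= (`|x| + t) ^+ 2.
    rewrite lerXn2r// ?nnegrE ?addr_ge0// ?(ltW t0)//.
    rewrite (le_trans (ler_normD _ _))// lerD2l normrZ ger0_norm ?(ltW t0)//.
    by rewrite ler_piMr// ltW.
  move=> h2; have : t * (2 * f h) <= t * (2 * `|x| + t).
    by apply: (le_trans (Ht t h)); move: h2; lra.
  by rewrite ler_pM2l//; lra.
have := dual_apply_le f x; rewrite fx expr2 => xf.
suff -> : `|f| = `|x| by [].
apply/eqP; rewrite eq_le fle/=; have [->//|x0] := eqVneq `|x| 0.
by rewrite -(@ler_pM2r _ `|x|)// lt_neqAle eq_sym x0 normr_ge0.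
Qed.

End DualityMap.

(** * Existence and continuity of the duality mapping *)

Section DualityExists.
Set Implicit Arguments.
Unset Strict Implicit.
Context {R : realType} {E : completeNormedModType R}.
Context (smE : uniformly_smooth E).
Implicit Types (x y h k p : E) (f g : top_dual E).

(* J x is obtained without Hahn-Banach, as the Gateaux derivative D of
   |.|^2 / 2 at x: D is sublinear by convexity of |.|^2 and odd by smoothness. *)
Section Gateaux.
Variable x : E.

Let G (t : R) h : R := (`|x + t *: h| ^+ 2 - `|x| ^+ 2) / (2 * t).

(** This bound keeps the infimum [D] finite and later yields [|D k| <= |x| |k|], hence
    continuity. *)
Let G_ge (t : R) h : 0 < t -> - (`|x| * `|h|) <= G t h.
Proof.
move=> t0; rewrite ler_pdivlMr ?mulr_gt0//.
have : `|x| - t * `|h| <= `|x + t *: h|.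
  have -> : t * `|h| = `|t *: h| by rewrite normrZ gtr0_norm.
  exact: lerB_normD.
move: (normr_ge0 x) (normr_ge0 h) (normr_ge0 (x + t *: h)).
set a := `|x|; set b := `|h|; set c := `|_| => a0 b0 c0 abc.
have tab : 0 <= t * (a * b) by rewrite mulr_ge0 ?(ltW t0)// mulr_ge0.
have [l|l] := leP 0 (a - t * b).
  have : (a - t * b) ^+ 2 <= c ^+ 2 by rewrite lerXn2r ?nnegrE.
  have := sqr_ge0 (t * b); lra.
have : a * a <= a * (t * b) by rewrite ler_wpM2l//; lra.
have := sqr_ge0 c; rewrite -expr2; lra.
Qed.

(** The point [x] is the convex combination of [x + s h] and [x - t h] with weights [t/(t + s)] and
    [s/(t + s)]. *)
Let G_opp (t s : R) h : 0 < t -> 0 < s -> 0 <= G s h + G t (- h).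
Proof.
move=> t0 s0; have ts0 : 0 < t + s by rewrite addr_gt0.
have := @norm_sq_convex R E (x + s *: h) (x + t *: - h) (t / (t + s)).
have -> : 0 <= t / (t + s) <= 1.
  by rewrite divr_ge0 ?(ltW t0) ?(ltW ts0)//= ler_pdivrMr// mul1r lerDl ltW.
have ts : 1 - t / (t + s) = s / (t + s) by field; rewrite gt_eqF.
move=> /(_ isT); rewrite ts.
have -> : t / (t + s) *: (x + s *: h) + s / (t + s) *: (x + t *: - h) = x.
  rewrite !scalerDr addrACA -scalerDl -mulrDl divff ?gt_eqF// scale1r.
  rewrite !scalerA scalerN -scalerBl [X in X *: _](_ : _ = 0) ?scale0r ?addr0//.
  by field; rewrite gt_eqF.
rewrite /G; set X := `|_| ^+ 2; set A := `|_| ^+ 2; set B := `|_| ^+ 2 => XAB.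
have : (t + s) * X <= t * A + s * B.
  have -> : t * A + s * B = (t + s) * (t / (t + s) * A + s / (t + s) * B).
    by field; rewrite gt_eqF.
  by rewrite ler_pM2l.
have -> : (A - X) / (2 * s) + (B - X) / (2 * t) =
    (t * A + s * B - (t + s) * X) / (2 * (s * t)).
  by field; rewrite !gt_eqF.
by move=> ?; rewrite divr_ge0 ?subr_ge0// mulr_ge0// ltW// mulr_gt0.
Qed.

Let G_smooth h (e : R) : 0 < e ->
  exists2 d : R, 0 < d & forall t : R, 0 < t < d -> G t h + G t (- h) <= e.
Proof.
move=> e0; have h1 : 0 < `|h| + 1 by rewrite ltr_wpDl.
have e0' : 0 < 2 * e / (`|h| + 1) by rewrite divr_gt0// mulr_gt0.
have [d d0 Hd] := uniformly_smooth_sq smE x e0'.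
exists (d / (`|h| + 1)); first by rewrite divr_gt0.
move=> t /andP[t0 td]; have := Hd (t *: h).
rewrite normrZ gtr0_norm// (le_lt_trans _ (_ : t * (`|h| + 1) < d))//; last 2 first.
- by rewrite ler_pM2l// lerDl.
- by rewrite -ltr_pdivlMr.
move=> /(_ isT) Ht; rewrite /G scalerN -mulrDl ler_pdivrMr ?mulr_gt0//.
have : 2 * e / (`|h| + 1) * (t * `|h|) <= 2 * e * t.
  rewrite [leRHS](_ : _ = 2 * e / (`|h| + 1) * (t * (`|h| + 1))).
    by rewrite !ler_pM2l// lerDl.
  by field; rewrite gt_eqF.
lra.
Qed.

(** The one-sided derivative, written as an infimum so that no limit has to be shown to exist;
    [D_near] recovers the limit behaviour. *)
Let D h : R := inf [set G t h | t in [set t | 0 < t]].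

Let D_ge h (a : R) : (forall t : R, 0 < t -> a <= G t h) -> a <= D h.
Proof.
move=> H; apply: lb_le_inf; first by exists (G 1 h), 1 => /=.
by move=> _ [t /= t0 <-]; exact: H.
Qed.

Let D_le h (t : R) : 0 < t -> D h <= G t h.
Proof.
move=> t0; apply: ge_inf; last by exists t.
by exists (- (`|x| * `|h|)) => _ [s /= s0 <-]; exact: G_ge.
Qed.

(** Smoothness, then convexity: [G t h <= e - G t (- h) <= e + G s h] for every [s > 0]; then take
    the infimum over [s]. *)
Let D_near h (e : R) : 0 < e ->
  exists2 d : R, 0 < d & forall t : R, 0 < t < d -> G t h <= D h + e.
Proof.
move=> e0; have [d d0 Hd] := G_smooth h e0; exists d => // t td.
rewrite -lerBlDr; apply: D_ge => s s0; have /andP[t0 _] := td.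
have := G_opp h t0 s0; have := Hd _ td; lra.
Qed.

(** [x + t (h + k)] is the midpoint of [x + 2 t h] and [x + 2 t k], whence the doubled step in the
    quotients on the right. *)
Let D_subadd h k : D (h + k) <= D h + D k.
Proof.
apply: le_of_eps => e e0; have e2 : 0 < e / 2 by rewrite divr_gt0.
have [d d0 Hd] := D_near h e2; have [d' d'0 Hd'] := D_near k e2.
have [t t0 /andP[td td']] : exists2 t : R, 0 < t & (2 * t < d) && (2 * t < d').
  exists (Num.min d d' / 4); first by rewrite divr_gt0// lt_min d0.
  by rewrite mulrCA -lt_min gtr_pMr ?lt_min ?d0//; lra.
have {}td : 0 < 2 * t < d by rewrite td mulr_gt0.
have {}td' : 0 < 2 * t < d' by rewrite td' mulr_gt0.
have := D_le (h + k) t0; have := Hd _ td; have := Hd' _ td'.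
suff : G t (h + k) <= G (2 * t) h + G (2 * t) k.
  by lra.
rewrite /G -mulrDl ler_pdivrMr ?mulr_gt0//.
have := @norm_sq_convex R E (x + (2 * t) *: h) (x + (2 * t) *: k) 2^-1.
have -> : 0 <= (2^-1 : R) <= 1 by lra.
move=> /(_ isT); have -> : (1 - 2^-1 : R) = 2^-1 by lra.
rewrite !scalerDr !scalerA !mulKf// addrACA -scalerDl.
have -> : (2^-1 + 2^-1 : R) = 1 by lra.
rewrite scale1r => H.
rewrite [leRHS](_ : _ = (`|x + (2 * t) *: h| ^+ 2 + `|x + (2 * t) *: k| ^+ 2) / 2
  - `|x| ^+ 2); last by field; rewrite gt_eqF.
by move: H; lra.
Qed.

Let D0 : D 0 = 0.
Proof.
apply/eqP; rewrite eq_le; apply/andP; split.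
  by rewrite (le_trans (D_le 0 ltr01))// /G scaler0 addr0 subrr mul0r.
by apply: D_ge => t _; rewrite /G scaler0 addr0 subrr mul0r.
Qed.

Let D_opp h : D (- h) = - D h.
Proof.
apply/eqP; rewrite eq_le; apply/andP; split.
  rewrite -subr_le0 opprK; apply: le_of_eps => e e0; rewrite add0r.
  have [d d0 Hd] := G_smooth h e0.
  have d2 : 0 < d / 2 by rewrite divr_gt0.
  have := D_le h d2; have := D_le (- h) d2.
  have : 0 < d / 2 < d by lra.
  by move/Hd; lra.
by rewrite -subr_ge0 opprK -D0 -(addNr h) D_subadd.
Qed.

Let D_add h k : D (h + k) = D h + D k.
Proof.
apply/eqP; rewrite eq_le D_subadd/=.
by have := D_subadd (h + k) (- k); rewrite D_opp addrK; lra.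
Qed.

Let D_pscale_le (a : R) h : 0 < a -> D (a *: h) <= a * D h.
Proof.
move=> a0; rewrite -ler_pdivrMl//; apply: D_ge => t t0.
rewrite ler_pdivrMl//; have ta : 0 < t / a by rewrite divr_gt0.
rewrite (le_trans (D_le _ ta))// /G scalerA divfK ?gt_eqF//.
rewrite [leLHS](_ : _ = a * ((`|x + t *: h| ^+ 2 - `|x| ^+ 2) / (2 * t)))//.
by field; rewrite !gt_eqF.
Qed.

Let D_pscale (a : R) h : 0 < a -> D (a *: h) = a * D h.
Proof.
move=> a0; apply/eqP; rewrite eq_le D_pscale_le//=.
have ai : 0 < a^-1 by rewrite invr_gt0.
have := D_pscale_le (a *: h) ai; rewrite scalerA mulVf ?gt_eqF// scale1r.
by rewrite ler_pdivlMl.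
Qed.

Let D_linear : linear (D : E -> R^o).
Proof.
move=> a h k; rewrite D_add; congr (_ + _).
rewrite -[RHS]/(a * D h).
have [a0|a0|->] := ltgtP a 0; last by rewrite scale0r mul0r D0.
  by rewrite -[a]opprK scaleNr D_opp D_pscale ?mulNr// oppr_gt0.
exact: D_pscale.
Qed.

Let D_continuous : continuous (D : E -> R^o).
Proof.
have D_lb k : - (`|x| * `|k|) <= D k by apply: D_ge => t; exact: G_ge.
have D_bound k : `|D k| <= `|x| * `|k|.
  by rewrite ler_norml D_lb/= -lerN2 -D_opp -(normrN k).
have x1 : 0 < `|x| + 1 by rewrite ltr_wpDl.
move=> p; apply/cvgrPdist_le => e e0; near=> q.
rewrite -[X in `|X|]/(D p - D q) -D_opp -D_add (le_trans (D_bound _))//.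
rewrite (@le_trans _ _ ((`|x| + 1) * `|p - q|))//.
  by rewrite ler_wpM2r// lerDl.
rewrite -ler_pdivlMl// ltW//; near: q.
by apply: cvgr_dist_lt; [exact: cvg_id|rewrite mulr_gt0// invr_gt0].
Unshelve. all: by end_near. Qed.

Lemma is_dual_exists : exists f, is_dual x f.
Proof.
have Df : (D : E -> R^o) \in @continuous_functional R E.
  by rewrite inE; split; [exact: D_linear|exact: D_continuous].
(* The bound of [D] by the quotient at [t = 1] is exactly the subgradient inequality. *)
exists (TopDual Df); apply: subgradient_is_dual => h /=.
have := D_le h ltr01; rewrite /G scale1r mulr1 ler_pdivlMr//; lra.
Qed.

End Gateaux.

(** Add the subgradient inequalities at [x] along [t k] and at [p] along [- t k]. The sum is the
    second difference at [p], small by smoothness, plus the cost of replacing [x] by [p]. Leaving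
    [f] and [g] arbitrary yields both uniqueness and norm continuity of the duality mapping. *)
Lemma is_dual_near p (e : R) : 0 < e -> exists2 d : R, 0 < d &
  forall x f g, `|p - x| < d -> is_dual x f -> is_dual p g -> `|g - f| <= e.
Proof.
move=> e0; have [d d0 Hd] := uniformly_smooth_sq smE p e0.
pose t := d / 2; have t0 : 0 < t by rewrite divr_gt0.
have q0 : 0 < 4 * `|p| + 4 + 2 * t.
  by rewrite ltr_wpDl ?mulr_gt0// addr_ge0// mulr_ge0.
(* Replacing [x] by [p] in two squared norms costs at most [eta (4 |p| + 4 + 2 t)], which must not
   exceed [e t]. *)
pose eta := Num.min 1 (e * t / (4 * `|p| + 4 + 2 * t)).
have eta1 : eta <= 1 by rewrite ge_min lexx.
have eta2 : eta * (4 * `|p| + 4 + 2 * t) <= e * t.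
  by rewrite -ler_pdivlMr// ge_min lexx orbT.
exists eta; first by rewrite lt_min ltr01 divr_gt0// mulr_gt0.
move=> x f g xp xf pg; rewrite -opprB normrN; apply: dual_norm_le => k k1.
have tk : `|t *: k| <= t by rewrite normrZ gtr0_norm// ler_piMr// ltW.
have td : t < d by rewrite /t; lra.
have B := Hd (t *: k) (le_lt_trans tk td).
have xh := is_dual_subgradient xf (t *: k).
have ph := is_dual_subgradient pg (- (t *: k)).
have x1 : `|x| <= `|p| + eta.
  by rewrite -lerBlDl (le_trans (lerB_dist _ _))// distrC ltW.
have p1 : `|p| <= `|x| + eta.
  by rewrite -lerBlDl (le_trans (lerB_dist _ _))// ltW.
have xk : `|x + t *: k| <= `|p + t *: k| + eta.
  rewrite -lerBlDl (le_trans (lerB_dist _ _))//.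
  by rewrite opprD addrACA subrr addr0 distrC ltW.
have pk : `|p + t *: k| <= `|p| + t by rewrite (le_trans (ler_normD _ _))// lerD2l.
have et : e * `|t *: k| <= e * t by rewrite ler_pM2l.
have E1 : t * (2 * ((f - g) k)) = 2 * f (t *: k) + 2 * g (- (t *: k)).
  by rewrite dual_subE dualN !dualZ; ring.
rewrite -(@ler_pM2l _ t)// -(@ler_pM2l _ 2)// mulrCA E1.
have sqb (a b : R) : 0 <= a -> 0 <= b -> a <= b + eta ->
    a ^+ 2 - b ^+ 2 <= eta * (2 * b + 1).
  move=> a0 b0 ab; have eta0 : 0 <= eta by lra.
  have [|ba] := leP a b; first by move=> ?; nra.
  have : (a - b) * (a + b) <= eta * (a + b) by rewrite ler_wpM2r//; lra.
  have : eta * (a + b) <= eta * (2 * b + 1) by rewrite ler_wpM2l//; lra.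
  by rewrite -subr_sqr; lra.
have := sqb _ _ (normr_ge0 _) (normr_ge0 _) xk.
have := sqb _ _ (normr_ge0 _) (normr_ge0 _) p1.
have eta0 : 0 <= eta by apply: le_trans (ltW xp).
have : eta * `|x| <= eta * (`|p| + eta) by rewrite ler_wpM2l.
have : eta * eta <= eta * 1 by rewrite ler_wpM2l.
have : eta * `|p + t *: k| <= eta * (`|p| + t) by rewrite ler_wpM2l.
move: B xh ph et eta2.
lra.
Qed.

Lemma duality_mapP x : is_dual x (duality_map x).
Proof. by apply: xgetPex; exact: is_dual_exists. Qed.

(** [is_dual_near] with both base points equal to [x] puts any two dual elements at distance
    zero. *)
Lemma duality_map_eq x f : is_dual x f -> duality_map x = f.
Proof.
move=> xf; apply/eqP; rewrite -subr_eq0 -normr_le0.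
apply: le_of_eps => e e0; rewrite add0r.
have [d d0 /(_ x)H] := is_dual_near x e0; apply: H xf (duality_mapP x).
by rewrite subrr normr0.
Qed.

Lemma duality_map_continuous : continuous (@duality_map R E).
Proof.
move=> p; apply/cvgrPdist_le => e e0.
have [d d0 Hd] := is_dual_near p e0.
near=> x; apply: (Hd x); [|exact: duality_mapP|exact: duality_mapP].
by near: x; apply: cvgr_dist_lt; first exact: cvg_id.
Unshelve. all: by end_near. Qed.

Lemma duality_map_sq x : duality_map x x = `|x| ^+ 2.
Proof. by have [] := duality_mapP x. Qed.

Lemma duality_map_norm x : `|duality_map x| = `|x|.
Proof.
have [_ /eqP] := duality_mapP x.
by rewrite eqrXn2 => // /eqP.
Qed.

End DualityExists.

(** * Generalized projections and the functional phi *)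

Section Projection.
Set Implicit Arguments.
Unset Strict Implicit.
Context {R : realType} {E : completeNormedModType R}.
Context (smE : uniformly_smooth E).
Context (cvE : two_uniformly_convex E).
Implicit Types (x y h p q z : E) (f g : top_dual E) (K : set E).

Local Notation J := (@duality_map R E).
Local Notation Jinv := (@duality_inv R E).

(** Packs a real of [0, 1] as the interval-typed scalar over which [convex_set] and
    [convex_function] quantify. *)
Lemma i01P (t : R) : 0 <= t <= 1 ->
  Itv.spec (Itv.num_sem (R:=R)) (Itv.Real `[0%Z, 1%Z]) t.
Proof.
by move=> t01; rewrite /Itv.spec/= /Itv.num_sem/= num_real/= in_itv.
Qed.

Lemma convex_setP K : convex_set (K : set (convex_lmodType E)) <->
  forall x y (t : R), K x -> K y -> 0 <= t <= 1 -> K (t *: x + (1 - t) *: y).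
Proof.
split=> [cK x y t Kx Ky /i01P ti|cK x y t xK yK].
  have := cK x y (Itv.Def ti); rewrite !inE; exact.
move: xK yK; rewrite !inE => Kx Ky; apply: cK => //.
by rewrite ge0/= le1.
Qed.

Lemma convex_functionW K (F : E -> R) x y (t : R) :
  convex_function (K : set (convex_lmodType E)) F -> K x -> K y -> 0 <= t <= 1 ->
  F (t *: x + (1 - t) *: y) <= t * F x + (1 - t) * F y.
Proof.
by move=> cF Kx Ky /i01P ti; exact: (cF (Itv.Def ti) x y (mem_set Kx) (mem_set Ky)).
Qed.

Lemma cvg_of_sq_dist (u : nat -> E) (a : nat -> R) (k : R) : 0 < k ->
  a n @[n --> \oo] --> (0 : R) ->
  (forall n m, (n <= m)%N -> k * `|u m - u n| ^+ 2 <= a n) ->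
  exists p, u n @[n --> \oo] --> p.
Proof.
move=> k0 a0 H; suff : cvg (u n @[n --> \oo]).
  by move=> ?; exists (lim (u n @[n --> \oo])).
apply/cauchy_cvgP/cauchyP => e e0.
have ke : 0 < k * e ^+ 2 by rewrite mulr_gt0// exprn_gt0.
have [N _ HN] := cvgr_dist_lt _ _ a0 _ ke.
exists (u N), N => // n /= Nn; rewrite -ball_normE/=.
have /= := HN N (leqnn N); rewrite sub0r normrN => /(le_lt_trans (ler_norm _)) aN.
have := le_lt_trans (H _ _ Nn) aN; rewrite ltr_pM2l// distrC.
by rewrite ltr_pXn2r ?nnegrE ?(ltW e0)//.
Qed.

(** Since [J y (x + y) <= |y| |x + y|], one gets [|x + y|^2 >= 4 J y x]; the quadratic convexity
    inequality then has right-hand side at most [2 phi x y]. *)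
Lemma sq_dist_phi : exists2 k : R, 0 < k &
  forall x y, k * `|x - y| ^+ 2 <= phi x y.
Proof.
have [k k0 Hk] := two_uniformly_convex_sq cvE.
exists (k / 2) => [|x y]; first by rewrite divr_gt0.
have := Hk x y; have := dual_apply_le (J y) (x + y).
rewrite dualD duality_map_sq// duality_map_norm// /phi.
have := sqr_ge0 (2 * `|y| - `|x + y|); lra.
Qed.

(* With K = E this yields surjectivity of J, with f = J y the generalized
   projection of y onto K. *)
Lemma energy_minimizer K f : K !=set0 -> closed K ->
    convex_set (K : set (convex_lmodType E)) ->
  exists z, K z /\ forall k, K k -> `|z| ^+ 2 - 2 * f z <= `|k| ^+ 2 - 2 * f k.
Proof.
move=> [k0 Kk0] clK /convex_setP cvK.
have [k kgt0 Hk] := two_uniformly_convex_sq cvE.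
pose g x : R := `|x| ^+ 2 - 2 * f x.
pose S := [set g x | x in K]; pose I := inf S.
have g_ge x : - `|f| ^+ 2 <= g x.
  by have := dual_apply_le f x; have := sqr_ge0 (`|f| - `|x|); rewrite /g; lra.
have lbS : has_lbound S by exists (- `|f| ^+ 2) => _ [x _ <-]; exact: g_ge.
have I_le x : K x -> I <= g x by move=> Kx; apply: ge_inf => //; exists x.
have [u Hu] : {u : nat -> E & forall n, K (u n) /\ g (u n) < I + n.+1%:R^-1}.
  apply: (@choice _ _ (fun n x => K x /\ g x < I + n.+1%:R^-1)) => n.
  have n0 : (0 : R) < n.+1%:R^-1 by rewrite invr_gt0.
  have [|_ [x Kx <-] gx] := @inf_adherent R S _ n0; last by exists x.
  by split=> //; exists (g k0), k0.
(* The midpoint lies in [K], so its energy is at least [I]; convexity turns this into a Cauchy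
   estimate for minimizing sequences. *)
have mid x y : K x -> K y -> k / 4 * `|x - y| ^+ 2 <= (g x + g y) / 2 - I.
  move=> Kx Ky; have := I_le _ (cvK x y 2^-1 Kx Ky _).
  have -> : (1 - 2^-1 : R) = 2^-1 by lra.
  have -> : 0 <= (2^-1 : R) <= 1 by lra.
  move=> /(_ isT); rewrite /g -scalerDr normrZ dualZ dualD.
  rewrite ger0_norm ?invr_ge0// exprMn; have := Hk x y; lra.
have k4 : 0 < k / 4 by rewrite divr_gt0.
have [||z uz] := @cvg_of_sq_dist u (fun n => n.+1%:R^-1) (k / 4) k4.
- exact: cvg_harmonic.
- move=> n m nm; have [Kn gn] := Hu n; have [Km gm] := Hu m.
  apply: (le_trans (mid _ _ Km Kn)).
  have : (m.+1%:R^-1 : R) <= n.+1%:R^-1 by rewrite lef_pV2 ?posrE// ler_nat ltnS.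
  by move: gn gm => /=; move: (n.+1%:R^-1) (m.+1%:R^-1) => s t; lra.
exists z; split.
  by apply: (closed_cvg K clK _ z uz); apply: nearW => n; have [] := Hu n.
move=> y /I_le Iy; apply: (le_trans _ Iy); rewrite -/(g z).
have gz : g (u n) @[n --> \oo] --> g z.
  apply: cvgB; first by rewrite expr2; apply: cvgM; apply: cvg_norm.
  apply: cvgMr; apply: (cvg_comp _ _ uz); exact: functional_continuous.
have Iz : I + n.+1%:R^-1 @[n --> \oo] --> I + 0.
  by apply: cvgD; [exact: cvg_cst|exact: cvg_harmonic].
rewrite -[I]addr0; apply: (ler_cvg_to gz Iz).
by apply: nearW => n; have [_ /ltW] := Hu n.
Qed.

(** First-order optimality. Along [z + t (k - z)], smoothness and the subgradient inequality in the
    opposite direction bound [|.|^2] above by [|z|^2 + 2 t J z (k - z)] plus a term of order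
    [e t]. *)
Lemma energy_minimizer_variational K f z :
    convex_set (K : set (convex_lmodType E)) -> K z ->
    (forall k, K k -> `|z| ^+ 2 - 2 * f z <= `|k| ^+ 2 - 2 * f k) ->
  forall k, K k -> 0 <= (J z - f) (k - z).
Proof.
move=> /convex_setP cvK Kz Hz k Kk; set h := k - z.
rewrite dual_subE subr_ge0; apply: le_of_eps => e e0.
have e0' : 0 < 2 * e / (`|h| + 1) by rewrite divr_gt0 ?mulr_gt0// ltr_wpDl.
have [d d0 Hd] := uniformly_smooth_sq smE z e0'.
pose t := Num.min 1 (d / (2 * (`|h| + 1))).
have h1 : 0 < `|h| + 1 by rewrite ltr_wpDl.
have t0 : 0 < t by rewrite lt_min ltr01 divr_gt0// mulr_gt0.
have t1 : t <= 1 by rewrite ge_min lexx.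
have td : t * `|h| < d.
  apply: (@le_lt_trans _ _ (t * (`|h| + 1))); first by rewrite ler_pM2l// lerDl.
  have : t <= d / (2 * (`|h| + 1)) by rewrite ge_min lexx orbT.
  rewrite ler_pdivlMr ?mulr_gt0//; lra.
have := Hd (t *: h); rewrite normrZ gtr0_norm//.
move=> /(_ td).
have := is_dual_subgradient (duality_mapP smE z) (- (t *: h)).
have := Hz _ (cvK _ _ t Kk Kz _); rewrite (ltW t0) t1 => /(_ isT).
have -> : t *: k + (1 - t) *: z = z + t *: h.
  by rewrite /h scalerBr scalerBl scale1r addrCA addrA.
rewrite dualN dualD !dualZ => a1 a2 a3.
have : 2 * e / (`|h| + 1) * (t * `|h|) <= 2 * (t * e).
  rewrite [leRHS](_ : _ = 2 * e / (`|h| + 1) * (t * (`|h| + 1))).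
    by rewrite !ler_pM2l// lerDl.
  by field; rewrite gt_eqF.
move=> a4; rewrite -(ler_pM2l t0); lra.
Qed.

(** Minimality of [|.|^2 - 2 f] at [x] over the whole space says that [f] is a subgradient at [x],
    hence its dual element. *)
Lemma duality_invK f : J (Jinv f) = f.
Proof.
suff [x /(duality_map_eq smE) xf] : exists x, is_dual x f.
  by apply: (xgetPex 0 (P := [set x | J x = f])); exists x.
have [||x [_ Hx]] := @energy_minimizer setT f _ closedT; first by exists 0.
  by apply/convex_setP.
exists x; apply: subgradient_is_dual => h; have := Hx (x + h) Logic.I.
by rewrite dualD; lra.
Qed.

Lemma phiE p y : phi p y = `|p| ^+ 2 - 2 * J y p + `|J y| ^+ 2.
Proof. by rewrite duality_map_norm. Qed.

Lemma phi_ge0 x y : 0 <= phi x y.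
Proof.
have [k k0 /(_ x y)] := sq_dist_phi; apply: le_trans.
by rewrite mulr_ge0 ?sqr_ge0// ltW.
Qed.

Lemma phi_three_point p x y :
  phi p y = phi p x + phi x y + 2 * (J x - J y) (p - x).
Proof. by rewrite /phi dual_subE !dualB !duality_map_sq//; ring. Qed.

(** The three-point identity for [y, x, y] reads [phi x y + phi y x = 2 (J x - J y)(x - y)]. *)
Lemma phi_le_norm x y : phi x y <= 2 * `|x - y| * (`|x| + `|y|).
Proof.
have := phi_three_point y x y; have := phi_ge0 y x.
rewrite [phi y y]/phi duality_map_sq// => p0 E0.
have le1 : (J x) (x - y) <= `|x| * `|x - y|.
  by rewrite -(duality_map_norm smE x) dual_apply_le.
have le2 : (J y) (y - x) <= `|y| * `|y - x|.
  by rewrite -[X in _ <= X * _](duality_map_norm smE y) dual_apply_le.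
move: E0; rewrite dual_subE; rewrite distrC in le2; move: le1 le2.
rewrite !dualB !duality_map_sq//; lra.
Qed.

Lemma phi_convex p y y1 y2 (t : R) : 0 <= t <= 1 ->
  J y = t *: J y1 + (1 - t) *: J y2 ->
  phi p y <= t * phi p y1 + (1 - t) * phi p y2.
Proof.
move=> t01 yE; rewrite !phiE yE dual_addE !dual_scaleE.
have := @norm_sq_convex R (top_dual E) (J y1) (J y2) t t01; lra.
Qed.

(** As a function of its first argument, [phi] is the energy for [f = J y] up to a constant. So
    minimizers exist, and the variational inequality is the sign of the cross term in the
    three-point identity. *)
Lemma gproj_phi K y : K !=set0 -> closed K ->
    convex_set (K : set (convex_lmodType E)) ->
  K (gproj K y) /\
  forall p, K p -> phi p (gproj K y) + phi (gproj K y) y <= phi p y.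
Proof.
move=> K0 clK cvK; rewrite /gproj.
case: xgetP => [z _ [Kz Hz]|].
  split=> // p Kp; rewrite (phi_three_point p z y) lerDl mulr_ge0//.
  apply: (energy_minimizer_variational cvK) => // k /Hz.
  by rewrite /phi; lra.
have [z [Kz Hz]] := energy_minimizer (J y) K0 clK cvK.
move=> /(_ z) []; split=> // k /Hz; rewrite /phi; lra.
Qed.

Lemma dual_pairing_cvg (T : Type) (F : set_system T) {FF : ProperFilter F}
    (G : T -> top_dual E) (u : T -> E) f p :
  G n @[n --> F] --> f -> u n @[n --> F] --> p -> G n (u n) @[n --> F] --> f p.
Proof.
move=> Gf up; rewrite -[f p]add0r.
have -> : (fun n => G n (u n)) = (fun n => (G n - f) (u n) + f (u n)).
  by apply/funext => n; rewrite dual_subE subrK.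
apply: cvgD; last by apply: (cvg_comp _ _ up); exact: functional_continuous.
apply: norm_cvg0; apply: (@squeeze_cvgr _ _ _ _ (fun=> 0) (fun n => `|G n - f| * `|u n|)).
- by apply: nearW => n; apply/andP; split; [exact: normr_ge0|exact: norm_dual_apply_le].
- exact: cvg_cst.
- rewrite -[0](mul0r `|p|); apply: cvgM; last exact: cvg_norm.
  rewrite -(@normr0 _ (top_dual E)) -(subrr f); apply: cvg_norm.
  by apply: cvgB => //; exact: cvg_cst.
Qed.

Lemma phi_cvg (T : Type) (F : set_system T) {FF : ProperFilter F} (u v : T -> E) p q :
  u n @[n --> F] --> p -> v n @[n --> F] --> q ->
  phi (u n) (v n) @[n --> F] --> phi p q.
Proof.
move=> up vq; have norm_sq (w : T -> E) r : w n @[n --> F] --> r ->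
    `|w n| ^+ 2 @[n --> F] --> `|r| ^+ 2.
  by move=> wr; rewrite expr2; apply: cvgM; apply: cvg_norm.
rewrite /phi; apply: cvgD; last exact: norm_sq.
apply: cvgB; first exact: norm_sq.
apply: cvgMr.
have Jv : J (v n) @[n --> F] --> J q.
  by apply: (cvg_comp _ _ vq); exact: duality_map_continuous.
exact: dual_pairing_cvg.
Qed.

End Projection.

(** * Limits along the iteration *)

Section Sequences.
Set Implicit Arguments.
Unset Strict Implicit.
Context {R : realType}.

Lemma squeeze_norm_cvg0 (V : normedModType R) (s : nat -> V) (b : nat -> R) :
  (\forall n \near \oo, `|s n| <= b n) -> b n @[n --> \oo] --> (0 : R) ->
  s n @[n --> \oo] --> (0 : V).
Proof.
move=> sb b0; apply: norm_cvg0.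
apply: (@squeeze_cvgr _ _ _ _ (fun=> 0) b _ _ 0 (cvg_cst _) b0).
by apply: filterS sb => n sb; rewrite normr_ge0.
Qed.

Lemma cvg_of_sub_cvg0 (V : normedModType R) (s t : nat -> V) (p : V) :
  s n - t n @[n --> \oo] --> (0 : V) -> s n @[n --> \oo] --> p ->
  t n @[n --> \oo] --> p.
Proof.
move=> st sp; rewrite -[p]subr0.
have -> : t = (fun n => s n - (s n - t n)).
  by apply/funext => n; rewrite subKr.
exact: cvgB.
Qed.

(** The liminf is the supremum of the tail infima, so some tail infimum is positive; it is finite
    because it lies below a real term. *)
Lemma liminf_gt0_near (s : nat -> R) :
  (0 < limn_einf (fun n => (s n)%:E))%E ->
  exists2 e : R, 0 < e & \forall n \near \oo, e <= s n.
Proof.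
rewrite limn_einf_lim (cvg_lim _ (cvg_einfs_sup (u := fun n => (s n)%:E)))//.
move=> /ereal_sup_gt[_ [N _ <-]] N0.
have lb n : (N <= n)%N -> (einfs (fun n => (s n)%:E) N <= (s n)%:E)%E.
  by move=> Nn; apply: ereal_inf_lbound; exists n.
move: N0 lb; case: (einfs _ N) => [e||]// e0 lb.
  by exists e; [rewrite -lte_fin|exists N => // n /= /lb; rewrite lee_fin].
by have := lb N (leqnn N); rewrite leye_eq.
Qed.

Lemma cvg_within_nbhs (V : topologicalType) (A : set V) (s : nat -> V) (p : V) :
  (forall n, A (s n)) -> s n @[n --> \oo] --> p ->
  s n @[n --> \oo] --> within A (nbhs p).
Proof.
move=> As sp X AX; have H : \forall n \near \oo, A (s n) -> X (s n) := sp _ AX.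
have : \forall n \near \oo, X (s n) by apply: filterS H => n; apply.
exact.
Qed.

Lemma within_continuous_cvg (V : topologicalType) (W : topologicalType)
    (A : set V) (f : V -> W) (s : nat -> V) (p : V) :
  {within A, continuous f} -> (forall n, A (s n)) -> A p ->
  s n @[n --> \oo] --> p -> f (s n) @[n --> \oo] --> f p.
Proof.
move=> /subspace_continuousP fc As Ap sp.
apply: (cvg_comp s f _ (fc p Ap)); exact: cvg_within_nbhs.
Qed.

(** Turns cyclic control into one fixed operator along a subsequence. Step [n] uses index [n.+1],
    and [cyclic] takes a predecessor, so the shifts cancel. *)
Lemma cyclic_subseq (d : nat) (d_gt0 : (0 < d)%N) (j : 'I_d) :
  (k * d + j)%N @[k --> \oo] --> \oo /\
  forall k, cyclic d_gt0 (k * d + j).+1 = j.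
Proof.
split.
  apply/cvgnyPge => N; exists N => // k /= Nk.
  by rewrite (leq_trans Nk)// (leq_trans (leq_pmulr k d_gt0))// leq_addr.
by move=> k; apply: val_inj; rewrite /= modnMDl modn_small.
Qed.

End Sequences.

(** * Estimates in [phi] for the mappings of the iteration, and limits of equilibrium
    inequalities *)

Section Mappings.
Set Implicit Arguments.
Unset Strict Implicit.
Context {R : realType} {E : completeNormedModType R}.
Context (smE : uniformly_smooth E).
Context (cvE : two_uniformly_convex E).
Implicit Types (x y h p q z : E) (f g : top_dual E) (K C : set E).

Local Notation J := (@duality_map R E).
Local Notation Jinv := (@duality_inv R E).

Lemma phi_cvg0_sub (s t : nat -> E) :
  phi (s n) (t n) @[n --> \oo] --> (0 : R) ->
  s n - t n @[n --> \oo] --> (0 : E).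
Proof.
have [k k0 Hk] := sq_dist_phi smE cvE => st; apply/cvgr0Pnorm_lt => e e0.
have ke : 0 < k * e ^+ 2 by rewrite mulr_gt0// exprn_gt0.
near=> n; have : `|0 - phi (s n) (t n)| < k * e ^+ 2.
  by near: n; exact: (cvgr_dist_lt _ _ st _ ke).
rewrite sub0r normrN => /(le_lt_trans (ler_norm _)).
move=> /(le_lt_trans (Hk _ _)); rewrite ltr_pM2l//.
by rewrite ltr_pXn2r ?nnegrE ?(ltW e0).
Unshelve. all: by end_near. Qed.

Lemma phi_bounded p (s : nat -> E) (M : R) : (forall n, phi p (s n) <= M) ->
  exists B : R, forall n, `|s n| <= B.
Proof.
(* A distance [r] with [r^2 <= M/k] satisfies [r <= 1 + M/k], which avoids square roots. *)
have [k k0 Hk] := sq_dist_phi smE cvE => sM; exists (`|p| + (1 + M / k)) => n.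
have : `|p - s n| ^+ 2 <= M / k by rewrite ler_pdivlMr// mulrC (le_trans (Hk _ _)).
have := lerB_dist (s n) p; rewrite distrC.
have := sqr_ge0 (`|p - s n| - 1); nra.
Qed.

(** The terms [|t|^2] cancel, leaving an inequality affine in [t]. *)
Lemma phi_halfspace (y1 y2 : E) : let H := [set t : E | phi t y1 <= phi t y2] in
  closed H /\ convex_set (H : set (convex_lmodType E)).
Proof.
have HE t : (phi t y1 <= phi t y2) = ((J y2 - J y1) t <= (`|y2| ^+ 2 - `|y1| ^+ 2) / 2).
  by rewrite dual_subE /phi; apply/idP/idP => ?; lra.
split.
  rewrite (_ : [set _ | _] =
      (J y2 - J y1) @^-1` [set r | r <= (`|y2| ^+ 2 - `|y1| ^+ 2) / 2]).
    apply: preimage_closed (@closed_le R _) => t _; exact: functional_continuous.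
  by apply/seteqP; split=> t /=; rewrite HE.
apply/convex_setP => s t l /=; rewrite !HE dualD !dualZ => Hs Ht /andP[l0 l1].
have l1' : 0 <= 1 - l by rewrite subr_ge0.
have := ler_wpM2l l0 Hs; have := ler_wpM2l l1' Ht; lra.
Qed.

(** For [n <= m] the point [x m] lies in [K n], so the projection inequality bounds
    [phi (x m) (x n)] by the increment of [phi (x _) x0], a nondecreasing sequence bounded by
    [phi q x0]. *)
Lemma shrinking_projection_cvg (K : nat -> set E) x0 q (x : nat -> E) :
    (forall n, closed (K n)) ->
    (forall n, convex_set (K n : set (convex_lmodType E))) ->
    (forall n, K n.+1 `<=` K n) -> (forall n, K n q) ->
    (forall n, x n = gproj (K n) x0) ->
  exists p, x n @[n --> \oo] --> p.
Proof.
move=> clK cvK subK Kq xE; have K0 n : K n !=set0 by exists q.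
have Kle n m : (n <= m)%N -> K m `<=` K n.
  by move=> /subnK <-; elim: (m - n)%N => [//|i IH]; apply: subset_trans (subK _) IH.
have xP n : K n (x n) /\ forall p, K n p -> phi p (x n) + phi (x n) x0 <= phi p x0.
  by rewrite xE; exact: gproj_phi.
have mono n m : (n <= m)%N -> phi (x m) (x n) <= phi (x m) x0 - phi (x n) x0.
  by move=> nm; rewrite lerBrDr; apply: (xP n).2; apply: (Kle _ _ nm); exact: (xP m).1.
pose a n := phi (x n) x0.
have a_mono : {homo a : n m / (n <= m)%N >-> n <= m}.
  by move=> n m /mono; rewrite /a; have := phi_ge0 smE cvE (x m) (x n); lra.
have a_ub : has_ubound (range a).
  exists (phi q x0) => _ [n _ <-]; rewrite /a.
  by have := (xP n).2 _ (Kq n); have := phi_ge0 smE cvE q (x n); lra.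
have aL := nondecreasing_cvgn a_mono a_ub.
have [k k0 Hk] := sq_dist_phi smE cvE.
apply: (@cvg_of_sq_dist _ _ x (fun n => sup (range a) - a n) k k0).
  by rewrite -[0](subrr (sup (range a))); apply: cvgB => //; exact: cvg_cst.
move=> n m nm; rewrite (le_trans (Hk _ _))// (le_trans (mono _ _ nm))//.
by rewrite lerD2r; apply: sup_upper_bound; [split=> //; exists (a 0%N), 0%N|exists m].
Qed.

(** Test the inequality of [u] at [p] and that of [p] at [u]. Monotonicity of [f] and of [B] (taken
    at [u] itself) leaves [(J u - J y)(p - u) >= 0], the cross term of the three-point identity. *)
Lemma gep_resolvent_phi C (f : E -> E -> R) (B : E -> top_dual E) (r : R) p u y :
    equilibrium_bifunction_on C f -> monotone_on C B -> 0 < r ->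
    GEP C f B p -> C u ->
    (forall t, C t -> 0 <= f u t + B u (t - u) + r^-1 * (J u - J y) (t - u)) ->
  phi p u + phi u y <= phi p y.
Proof.
move=> [_ f2 _ _] Bm r0 [Cp Hp] Cu Hu; rewrite (phi_three_point smE p u y) lerDl.
have := Hu p Cp; have := Hp u Cu; have := f2 _ _ Cu Cp; have := Bm _ _ Cp Cu.
rewrite dual_subE !dualB => h1 h2 h3 h4.
suff : 0 <= r^-1 * (J u - J y) (p - u).
  by rewrite dualB pmulr_rge0 ?invr_gt0//; lra.
by rewrite dualB; lra.
Qed.

(** The three-point identity gives [phi p q + 2 l A x (q - p) <= phi p x]. Split [q - p] at [x]:
    inverse strong monotonicity handles [x - p], and the constant [c] bounds [|q - x|] by
    [(2 l / c^2) |A x|]. *)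
Lemma ism_forward_phi C (A : E -> top_dual E) (g c l : R) p x q :
    two_uc_constant E c -> inverse_strongly_monotone_on C g A -> 0 <= l ->
    C p -> A p = 0 -> C x -> J q = J x - l *: A x ->
  phi p q + 2 * l * (g - 2 * l / c ^+ 2) * `|A x| ^+ 2 <= phi p x.
Proof.
move=> [/andP[c0 _] Hc] Aism l0 Cp Ap Cx qE.
have := Aism _ _ Cx Cp; rewrite Ap subr0 => Axp.
have qx : `|q - x| <= 2 / c ^+ 2 * (l * `|A x|).
  by rewrite (le_trans (Hc _ _))// qE addrAC subrr sub0r normrN normrZ ger0_norm.
have Axq : A x (x - q) <= `|A x| * (2 / c ^+ 2 * (l * `|A x|)).
  by rewrite (le_trans (dual_apply_le _ _))// ler_wpM2l// distrC.
have Aqp : g * `|A x| ^+ 2 - 2 / c ^+ 2 * (l * `|A x| ^+ 2) <= A x (q - p).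
  have -> : A x (q - p) = A x (x - p) - A x (x - q).
    by rewrite !dualB; ring.
  by move: Axq; lra.
have := ler_wpM2l l0 Aqp.
have : phi p q + 2 * l * A x (q - p) <= phi p x.
  have -> : phi p x = phi p q + phi q x + 2 * l * A x (q - p).
    rewrite (phi_three_point smE p q x) qE; congr (_ + _).
    by rewrite addrAC subrr sub0r dual_oppE dual_scaleE !dualB; ring.
  by rewrite lerD2r lerDl phi_ge0.
lra.
Qed.

(** Inverse strong monotonicity makes [A] Lipschitz on [C] with constant [1/g]. *)
Lemma ism_continuous C (A : E -> top_dual E) (g : R) (s : nat -> E) p :
    0 < g -> inverse_strongly_monotone_on C g A ->
    (forall n, C (s n)) -> C p -> s n @[n --> \oo] --> p ->
  A (s n) @[n --> \oo] --> A p.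
Proof.
move=> g0 Aism Cs Cp sp; apply: cvg_sub0 (cvg_cst (A p)).
have le n : `|A (s n) - A p| <= g^-1 * `|s n - p|.
  have := le_trans (Aism _ _ (Cs n) Cp) (dual_apply_le _ _).
  have [->|A0] := eqVneq `|A (s n) - A p| 0.
    by rewrite mulr_ge0// invr_ge0 ltW.
  rewrite expr2 mulrCA ler_pM2l ?lt_neqAle ?normr_ge0 ?andbT 1?eq_sym//.
  by rewrite ler_pdivlMl.
apply: (squeeze_norm_cvg0 (b := fun n => g^-1 * `|s n - p|)).
  by apply: nearW => n; exact: le.
rewrite -[X in _ --> X](mulr0 g^-1); apply: cvgMr.
rewrite -(@normr0 _ E); apply: cvg_norm; rewrite -(subrr p).
by apply: cvgB => //; exact: cvg_cst.
Qed.

(* Minty's argument: the inequality is first transferred to [f t p], where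
   lower semicontinuity applies, then pulled back along segments from p. *)
Lemma GEP_limit C (f : E -> E -> R) (B : E -> top_dual E) (u : nat -> E)
    (g : nat -> top_dual E) p :
    convex_set (C : set (convex_lmodType E)) ->
    equilibrium_bifunction_on C f -> {within C, continuous B} -> C p ->
    (forall n, C (u n)) -> u n @[n --> \oo] --> p ->
    g n @[n --> \oo] --> (0 : top_dual E) ->
    (forall n t, C t -> 0 <= f (u n) t + B (u n) (t - u n) + g n (t - u n)) ->
  GEP C f B p.
Proof.
move=> cvC [f1 f2 f3 f4] Bc Cp Cu up g0 H.
have BuB := within_continuous_cvg Bc Cu Cp up.
have up_within := cvg_within_nbhs Cu up.
have ftp t : C t -> f t p <= B p (t - p).
  move=> Ct; rewrite leNgt; apply/negP => Bf.
  (* A level strictly between the two sides: [f t (u n)] eventually exceeds it by semicontinuity,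
     while (A2) and [H] bound [f t (u n)] by a sequence tending to [B p (t - p)]. *)
  pose a := (f t p + B p (t - p)) / 2.
  have af : a < f t p by rewrite /a; lra.
  have near_a : \forall n \near \oo, a < f t (u n) :=
    up_within _ ((f4 t Ct).2 p a Cp af).
  have tu : t - u n @[n --> \oo] --> t - p by apply: cvgB => //; exact: cvg_cst.
  have lim : B (u n) (t - u n) + g n (t - u n) @[n --> \oo] --> B p (t - p) + 0.
    by apply: cvgD; [exact: dual_pairing_cvg|exact: (dual_pairing_cvg g0 tu)].
  have : a <= B p (t - p) + 0.
    apply: (ler_cvg_to (cvg_cst a) lim); near=> n.
    have an : a < f t (u n) by near: n.
    by have := H n t Ct; have := f2 _ _ Ct (Cu n); lra.
  by rewrite /a; lra.
split=> // t Ct; pose b : R := B p (t - p).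
pose T (s : R) := s *: t + (1 - s) *: p.
have CT s : 0 < s <= 1 -> C (T s).
  by move=> /andP[s0 s1]; apply: (convex_setP C).1 => //; rewrite (ltW s0).
(* Convexity gives [0 = f (T s) (T s) <= s f (T s) t + (1 - s) f (T s) p]; bound the last value by
   [s b] and divide by [s]. *)
have fT s : 0 < s <= 1 -> - (1 - s) * b <= f (T s) t.
  move=> s01; have CTs := CT s s01; have /andP[s0 s1] := s01.
  have fTp := ftp _ CTs.
  have TpE : T s - p = s *: (t - p).
    by rewrite /T scalerBl scale1r scalerBr -addrA addrAC subrr sub0r.
  rewrite TpE dualZ -/b in fTp.
  have s01' : 0 <= s <= 1 by rewrite (ltW s0).
  have := convex_functionW (f4 _ CTs).1 Ct Cp s01'; rewrite -/(T s) f1// => f0.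
  have : (1 - s) * f (T s) p <= (1 - s) * (s * b) by rewrite ler_wpM2l// subr_ge0.
  move=> h; rewrite -(ler_pM2l s0); move: f0 h; lra.
have [l [Tl lf]] := f3 p t t Cp Ct Ct.
suff : ((- b)%:E <= l)%E.
  by move=> /le_trans/(_ lf); rewrite lee_fin -/b; lra.
have bl : (- (1 - s) * b)%:E @[s --> (0:R)^'+] --> (- b)%:E.
  apply: cvg_EFin; first by near=> s.
  apply: cvg_at_right_filter.
  rewrite -[X in _ --> X](_ : - (1 - 0) * b = - b); last by rewrite subr0 mulN1r.
  apply: cvgMl; apply: cvgN; apply: cvgB; [exact: cvg_cst|exact: cvg_id].
apply: (lee_cvg_to bl Tl); near=> s; rewrite lee_fin; apply: fT.
by apply/andP; split; [near: s; exact: nbhs_right_gt|near: s; apply: nbhs_right_le].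
Unshelve. all: by end_near. Qed.

End Mappings.

(** * Norm convergence of the iteration to a common solution *)

Theorem theorem1 (R : realType) (E : completeNormedModType R)
  (E_convex : two_uniformly_convex E) (E_smooth : uniformly_smooth E)
  (c : R) (c_cst : two_uc_constant E c)
  (C : set E) (C_neq0 : C !=set0) (C_closed : closed C)
  (C_convex : convex_set (C : set (convex_lmodType E)))
  (f1 f2 : E -> E -> R)
  (f1_eq : equilibrium_bifunction_on C f1)
  (f2_eq : equilibrium_bifunction_on C f2)
  (B1 B2 : E -> top_dual E)
  (B1_cont : {within C, continuous B1}) (B1_mono : monotone_on C B1)
  (B2_cont : {within C, continuous B2}) (B2_mono : monotone_on C B2)
  (d : nat) (d_gt0 : (0 < d)%N) (T : 'I_d -> E -> E)
  (T_stable : forall j x, C x -> C (T j x))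
  (T_cont : forall j, {within C, continuous (T j)})
  (T_rne : forall j, relatively_nonexpansive_on C (T j))
  (m : nat) (m_gt0 : (0 < m)%N) (A : 'I_m -> E -> top_dual E)
  (gamma_ : 'I_m -> R) (gamma_itv : forall i, 0 < gamma_ i < 1)
  (A_ism : forall i, inverse_strongly_monotone_on C (gamma_ i) (A i))
  (F := (\bigcap_j fixed_points_on C (T j)) `&`
        (\bigcap_i zeros_on C (A i)) `&`
        (GEP C f1 B1 `&` GEP C f2 B2))
  (F_neq0 : F !=set0)
  (gamma := \big[Num.min/1]_(i < m) gamma_ i)
  (alpha lambda r : nat -> R) (beta a b c1 : R)
  (c1_gt0 : 0 < c1) (r_ge : forall n, c1 <= r n)
  (beta_itv : 0 < beta < 1)
  (alpha_itv : forall n, 0 < alpha n < 1)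
  (alpha_liminf : (0 < limn_einf (fun n => (alpha n * (1 - alpha n))%:E))%E)
  (a_gt0 : 0 < a) (a_lt_b : a < b) (b_lt : b < c ^+ 2 * gamma / 2)
  (lambda_itv : forall n, a <= lambda n <= b)
  (J := @duality_map R E) (Jinv := @duality_inv R E)
  (x z y u v w : nat -> E) (C_ : nat -> set E)
  (C_0 : C_ 0%N = C) (x_0 : C (x 0%N))
  (z_def : forall n, z n =
     gproj C (Jinv (J (x n) - lambda n *: A (cyclic m_gt0 n.+1) (x n))))
  (y_def : forall n, y n =
     Jinv (alpha n *: J (x n) +
           (1 - alpha n) *: J (T (cyclic d_gt0 n.+1) (z n))))
  (u_C : forall n, C (u n))
  (u_def : forall n t, C t ->
     0 <= f1 (u n) t + B1 (u n) (t - u n)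
          + (r n)^-1 * (J (u n) - J (y n)) (t - u n))
  (v_C : forall n, C (v n))
  (v_def : forall n t, C t ->
     0 <= f2 (v n) t + B2 (v n) (t - v n)
          + (r n)^-1 * (J (v n) - J (y n)) (t - v n))
  (w_def : forall n, w n =
     Jinv (beta *: J (u n) + (1 - beta) *: J (v n)))
  (C_S : forall n, C_ n.+1 =
     [set t | C_ n t /\ phi t (w n) <= phi t (x n)])
  (x_S : forall n, x n.+1 = gproj (C_ n.+1) (x 0%N)) :
  exists2 p, F p & x n @[n --> \oo] --> p.
Proof.
rewrite {}/J {}/Jinv in z_def y_def u_def v_def w_def *.
have [q [[qT qA] [qG1 qG2]]] := F_neq0.
have [/andP[beta0 beta1] [/andP[c0 c1lt] Hc]] := (beta_itv, c_cst).
have b0 : 0 < b by apply: lt_trans a_lt_b.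
have betaN0 : 0 < 1 - beta by rewrite subr_gt0.
have c2_gt0 : 0 < c ^+ 2 by rewrite exprn_gt0.
have r_gt0 n : 0 < r n by apply: lt_le_trans (r_ge n).
have gamma_le i : gamma <= gamma_ i by exact: bigmin_le_cond.
have Cq : C q by case: qG1.
(* A lower bound for the coefficient [2 l (gamma_ i - 2 l / c^2)] of [ism_forward_phi], uniform in
   [i] and in [l] between [a] and [b]. *)
pose kappa := 2 * a * (gamma - 2 * b / c ^+ 2).
have kappa0 : 0 < kappa.
  rewrite mulr_gt0 ?mulr_gt0// subr_gt0 ltr_pdivrMr//.
  by move: b_lt; rewrite ltr_pdivlMr//; lra.
pose Ax n := A (cyclic m_gt0 n.+1) (x n).
pose Tz n := T (cyclic d_gt0 n.+1) (z n).
pose Q n := duality_inv (duality_map (x n) - lambda n *: Ax n).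
have JQ n : duality_map (Q n) = duality_map (x n) - lambda n *: Ax n.
  exact: duality_invK.
have Jy n : duality_map (y n) =
    alpha n *: duality_map (x n) + (1 - alpha n) *: duality_map (Tz n).
  by rewrite y_def; exact: duality_invK.
have Jw n : duality_map (w n) =
    beta *: duality_map (u n) + (1 - beta) *: duality_map (v n).
  by rewrite w_def; exact: duality_invK.
have zP n : C (z n) /\ forall p, C p -> phi p (z n) + phi (z n) (Q n) <= phi p (Q n).
  by rewrite z_def; exact: gproj_phi.
have phi0 := phi_ge0 E_smooth E_convex.
(* [u_def] and [v_def] evaluate [B1] and [B2] at [u n] and [v n], not at [y n]; this is the form
   that [gep_resolvent_phi] takes. *)
have phi_u n : phi q (u n) + phi (u n) (y n) <= phi q (y n).
  exact: (gep_resolvent_phi E_smooth f1_eq B1_mono (r_gt0 n) qG1 (u_C n) (u_def n)).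
have phi_v n : phi q (v n) + phi (v n) (y n) <= phi q (y n).
  exact: (gep_resolvent_phi E_smooth f2_eq B2_mono (r_gt0 n) qG2 (v_C n) (v_def n)).
have beta01 : 0 <= beta <= 1 by rewrite !ltW.
have phi_w p n : phi p (w n) <= beta * phi p (u n) + (1 - beta) * phi p (v n).
  exact: phi_convex.
have phi_y n : C (x n) ->
    phi q (y n) + (1 - alpha n) * (kappa * `|Ax n| ^+ 2) <= phi q (x n).
  move=> Cx; have /andP[al0 al1] := alpha_itv n.
  have al01 : 0 <= alpha n <= 1 by rewrite !ltW.
  have := phi_convex E_smooth q al01 (Jy n).
  have [_ Tq _] := T_rne (cyclic d_gt0 n.+1).
  have := Tq (z n) q (zP n).1 (qT (cyclic d_gt0 n.+1) Logic.I); rewrite -/(Tz n).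
  have := (zP n).2 q Cq; have := phi0 (z n) (Q n).
  have /andP[la lb] := lambda_itv n.
  have l0 : 0 <= lambda n by rewrite ltW// (lt_le_trans a_gt0).
  have [_ Aq] := qA (cyclic m_gt0 n.+1) Logic.I.
  have := ism_forward_phi E_smooth E_convex c_cst (A_ism (cyclic m_gt0 n.+1))
    l0 Cq Aq Cx (JQ n); rewrite -/(Ax n).
  have : kappa * `|Ax n| ^+ 2 <= 2 * lambda n *
      (gamma_ (cyclic m_gt0 n.+1) - 2 * lambda n / c ^+ 2) * `|Ax n| ^+ 2.
    rewrite ler_wpM2r ?sqr_ge0// /kappa.
    have k1 : gamma - 2 * b / c ^+ 2 <=
        gamma_ (cyclic m_gt0 n.+1) - 2 * lambda n / c ^+ 2.
      by rewrite lerB// ler_pM2r ?invr_gt0// ler_pM2l.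
    apply: ler_pM => //; last by rewrite ler_pM2l.
      by rewrite mulr_ge0// ltW.
    by move: kappa0; rewrite pmulr_rgt0 ?mulr_gt0// => /ltW.
  set e := kappa * _; set e' := _ * `|Ax n| ^+ 2 => ee' hQ hz0 hz hT hy.
  have : (1 - alpha n) * phi q (Tz n) <= (1 - alpha n) * (phi q (x n) - e).
    by rewrite ler_wpM2l ?subr_ge0 ?(ltW al1)//; lra.
  lra.
have phi_wx n : C (x n) -> phi q (w n) + beta * phi (u n) (y n)
    + (1 - beta) * phi (v n) (y n)
    + (1 - alpha n) * (kappa * `|Ax n| ^+ 2) <= phi q (x n).
  move=> /phi_y; have := phi_w q n.
  have := ler_wpM2l (ltW beta0) (phi_u n); have := ler_wpM2l (ltW betaN0) (phi_v n).
  lra.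
have kA0 n : 0 <= (1 - alpha n) * (kappa * `|Ax n| ^+ 2).
  have /andP[_ al1] := alpha_itv n.
  by rewrite mulr_ge0 ?subr_ge0 ?(ltW al1)// mulr_ge0 ?sqr_ge0// ltW.
have phi_uy0 n : 0 <= beta * phi (u n) (y n) by rewrite mulr_ge0// ltW.
have phi_vy0 n : 0 <= (1 - beta) * phi (v n) (y n) by rewrite mulr_ge0// ltW.
(* The invariants go together: [x n] in [C] is needed to put [q] in the next set, and [q] makes that
   set nonempty, so that [x n.+1] is a genuine projection. *)
have C_P n : [/\ closed (C_ n), convex_set (C_ n : set (convex_lmodType E)),
    C_ n `<=` C, C_ n q & C_ n (x n)].
  elim: n => [|n [clK cvK sK Kq Kx]]; first by rewrite C_0; split.
  have [clH cvH] := phi_halfspace (w n) (x n).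
  have KS : C_ n.+1 = C_ n `&` [set t | phi t (w n) <= phi t (x n)].
    by rewrite C_S.
  have clS : closed (C_ n.+1) by rewrite KS; exact: closedI.
  have cvS : convex_set (C_ n.+1 : set (convex_lmodType E)).
    rewrite KS; apply/convex_setP => s t l [Ks Hs] [Kt Ht] l01.
    by split; [exact: (convex_setP _).1|exact: (convex_setP _).1].
  have Sq : C_ n.+1 q.
    rewrite KS; split=> //=; have := phi_wx n (sK _ Kx).
    have := kA0 n; have := phi_uy0 n; have := phi_vy0 n; lra.
  split=> //; first by rewrite KS => t [/sK].
  rewrite x_S; have S0 : C_ n.+1 !=set0 by exists q.
  by have [] := gproj_phi E_smooth E_convex (x 0%N) S0 clS cvS.
have Cx n : C (x n) by have [_ _ sK _ Kx] := C_P n; exact: sK.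
(* Shifted by one, since [x 0] is arbitrary and only the later terms are given as projections. *)
have [p xSp] : exists p : E, x n.+1 @[n --> \oo] --> p.
  apply: (@shrinking_projection_cvg _ _ E_smooth E_convex (fun n => C_ n.+1)
      (x 0%N) q (fun n => x n.+1)).
  - by move=> n; have [] := C_P n.+1.
  - by move=> n; have [] := C_P n.+1.
  - by move=> n t; rewrite (C_S n.+1) => -[].
  - by move=> n; have [] := C_P n.+1.
  - exact: x_S.
have xp : x n @[n --> \oo] --> p by rewrite -(cvg_shiftS x (nbhs p)).
have Cp : C p by apply: (closed_cvg C C_closed _ p xp); exact: nearW.
have phi_limit (s t : nat -> E) s0 t0 := @phi_cvg R E E_smooth nat \oo _ s t s0 t0.
have wp : w n @[n --> \oo] --> p.
  apply: (cvg_of_sub_cvg0 _ xSp); apply: (phi_cvg0_sub E_smooth E_convex).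
  apply: (squeeze_norm_cvg0 (b := fun n => phi (x n.+1) (x n))).
    apply: nearW => n; rewrite ger0_norm//.
    by have [_ _ _ _] := C_P n.+1; rewrite C_S => -[].
  have -> : (0 : R) = phi p p by rewrite /phi duality_map_sq//; ring.
  exact: phi_limit.
pose delta n := phi q (x n) - phi q (w n).
have delta0 : delta n @[n --> \oo] --> (0 : R).
  rewrite -[0](subrr (phi q p)); apply: cvgB; apply: phi_limit => //; exact: cvg_cst.
have sub_y0 (s : nat -> E) (e : R) : 0 < e ->
    (forall n, e * phi (s n) (y n) <= delta n) ->
    s n - y n @[n --> \oo] --> (0 : E).
  move=> e0 Hs; apply: (phi_cvg0_sub E_smooth E_convex).
  apply: (squeeze_norm_cvg0 (b := fun n => e^-1 * delta n)).
    by apply: nearW => n; rewrite ger0_norm// ler_pdivlMl.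
  by rewrite -(mulr0 e^-1); apply: cvgMr.
have uy0 : u n - y n @[n --> \oo] --> (0 : E).
  apply: (sub_y0 u beta beta0) => n; have := phi_wx n (Cx n).
  by have := kA0 n; have := phi_vy0 n; rewrite /delta; lra.
have vy0 : v n - y n @[n --> \oo] --> (0 : E).
  apply: (sub_y0 v (1 - beta) betaN0) => n; have := phi_wx n (Cx n).
  by have := kA0 n; have := phi_uy0 n; rewrite /delta; lra.
(* Because [alpha n (1 - alpha n) <= 1 - alpha n]. *)
have [e e0 alpha_e] : exists2 e : R, 0 < e & \forall n \near \oo, e <= 1 - alpha n.
  have [e e0 He] := liminf_gt0_near alpha_liminf; exists e => //.
  apply: filterS He => n /le_trans; apply.
  have /andP[al0 al1] := alpha_itv n.
  by rewrite ler_piMl ?subr_ge0 ?(ltW al1).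
have Ax0 : Ax n @[n --> \oo] --> (0 : top_dual E).
  have A2 : `|Ax n| ^+ 2 @[n --> \oo] --> (0 : R).
    apply: (squeeze_norm_cvg0 (b := fun n => (e * kappa)^-1 * delta n)).
      apply: filterS alpha_e => n en; rewrite ger0_norm ?sqr_ge0//.
      rewrite ler_pdivlMl ?(mulr_gt0 e0 kappa0)// -mulrA.
      have k0 : 0 <= kappa * `|Ax n| ^+ 2 by rewrite mulr_ge0 ?sqr_ge0// ltW.
      apply: (le_trans (ler_wpM2r k0 en)); have := phi_wx n (Cx n).
      by have := phi_uy0 n; have := phi_vy0 n; rewrite /delta; lra.
    by rewrite -(mulr0 (e * kappa)^-1); apply: cvgMr.
  apply/cvgr0Pnorm_lt => eps eps0; near=> n.
  have : `|0 - `|Ax n| ^+ 2| < eps ^+ 2.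
    by near: n; apply: (cvgr_dist_lt _ _ A2); rewrite exprn_gt0.
  rewrite sub0r normrN ger0_norm ?sqr_ge0//.
  by rewrite ltr_pXn2r ?nnegrE ?(ltW eps0).
(* Bounds on [u] and [v] are needed before their convergence is known, since [phi_le_norm] carries
   the factor [|u n| + |v n|]. *)
have [M xM] : exists M, forall n, phi q (x n) <= M.
  have /cvg_seq_bounded[M [_ /(_ (M + 1))]] : cvg (phi q (x n) @[n --> \oo]).
    by apply/cvg_ex; exists (phi q p); apply: phi_limit => //; exact: cvg_cst.
  rewrite ltrDl ltr01 => /(_ isT) HM; exists (M + 1) => n.
  by apply: (le_trans (ler_norm _)); exact: HM.
have yM n : phi q (y n) <= M.
  by have := phi_y n (Cx n); have := kA0 n; have := xM n; lra.
have [Mu uM] : exists B : R, forall n, `|u n| <= B.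
  apply: (phi_bounded E_smooth E_convex (p := q) (M := M)) => n.
  by have := phi_u n; have := phi0 (u n) (y n); have := yM n; lra.
have [Mv vM] : exists B : R, forall n, `|v n| <= B.
  apply: (phi_bounded E_smooth E_convex (p := q) (M := M)) => n.
  by have := phi_v n; have := phi0 (v n) (y n); have := yM n; lra.
have uv0 : u n - v n @[n --> \oo] --> (0 : E).
  have -> : (fun n => u n - v n) = (fun n => (u n - y n) - (v n - y n)).
    by apply/funext => n; rewrite opprB addrA subrK.
  by rewrite -(subr0 (0 : E)); apply: cvgB.
(* Only [J (w n)] is a convex combination, so compare through [phi]: [phi (u n) (w n) <= (1 - beta)
   phi (u n) (v n)], which vanishes with [u n - v n]. *)
have up : u n @[n --> \oo] --> p.
  apply: (cvg_of_sub_cvg0 _ wp).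
  have -> : (fun n => w n - u n) = (fun n => - (u n - w n)).
    by apply/funext => n; rewrite opprB.
  rewrite -(oppr0 E); apply: cvgN; apply: (phi_cvg0_sub E_smooth E_convex).
  apply: (squeeze_norm_cvg0 (b := fun n => (2 * (Mu + Mv)) * `|u n - v n|)).
    apply: nearW => n; rewrite ger0_norm//.
    have := phi_w (u n) n; have := phi_le_norm E_smooth E_convex (u n) (u n).
    rewrite subrr normr0 mulr0 mul0r => uu wu.
    have := phi_le_norm E_smooth E_convex (u n) (v n).
    have : `|u n - v n| * (`|u n| + `|v n|) <= `|u n - v n| * (Mu + Mv).
      by rewrite ler_wpM2l// lerD.
    have := ler_wpM2l (ltW beta0) uu; have := phi0 (u n) (v n).
    have : 0 <= beta * phi (u n) (v n) by rewrite mulr_ge0// ltW.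
    move: wu; lra.
  rewrite -(mulr0 (2 * (Mu + Mv))); apply: cvgMr.
  by rewrite -(@normr0 _ E); exact: cvg_norm.
have yp := cvg_of_sub_cvg0 uy0 up.
have vp : v n @[n --> \oo] --> p.
  apply: (cvg_of_sub_cvg0 _ up); exact: uv0.
have Jlim (s : nat -> E) : s n @[n --> \oo] --> p ->
    duality_map (s n) @[n --> \oo] --> duality_map p.
  move=> sp; apply: (cvg_comp _ _ sp); exact: duality_map_continuous.
have Jsub (s t : nat -> E) : s n @[n --> \oo] --> p -> t n @[n --> \oo] --> p ->
    `|duality_map (s n) - duality_map (t n)| @[n --> \oo] --> (0 : R).
  move=> sp tp; rewrite -(@normr0 _ (top_dual E)) -(subrr (duality_map p)).
  by apply: cvg_norm; apply: cvgB; exact: Jlim.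
(* [J (x n) - J (y n)] is [1 - alpha n] times [J (x n) - J (Tz n)]; divide by [e] and return to
   points through the constant [c]. *)
have Tzp : Tz n @[n --> \oo] --> p.
  apply: (cvg_of_sub_cvg0 _ xp).
  apply: (squeeze_norm_cvg0 (b := fun n => (2 / c ^+ 2 / e)
    * `|duality_map (x n) - duality_map (y n)|)).
    apply: filterS alpha_e => n en; apply: (le_trans (Hc _ _)).
    rewrite -[leRHS]mulrA ler_pM2l ?divr_gt0// ler_pdivlMl//.
    have -> : duality_map (x n) - duality_map (y n) =
        (1 - alpha n) *: (duality_map (x n) - duality_map (Tz n)).
      rewrite Jy scalerBr [X in _ = X - _]scalerBl scale1r opprD addrA.
      by rewrite -addrA.
    rewrite normrZ ler_wpM2r// (le_trans en)// ler_norm//.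
  rewrite -(mulr0 (2 / c ^+ 2 / e)); apply: cvgMr; exact: Jsub.
have Qp : Q n @[n --> \oo] --> p.
  apply: (cvg_of_sub_cvg0 _ xp).
  apply: (squeeze_norm_cvg0 (b := fun n => (2 / c ^+ 2 * b) * `|Ax n|)).
    apply: nearW => n; apply: (le_trans (Hc _ _)).
    rewrite -[leRHS]mulrA ler_pM2l ?divr_gt0// JQ opprB addrC subrK normrZ.
    have /andP[la lb] := lambda_itv n.
    by rewrite ler_wpM2r// ger0_norm// (le_trans (ltW a_gt0)).
  rewrite -(mulr0 (2 / c ^+ 2 * b)); apply: cvgMr.
  by rewrite -(@normr0 _ (top_dual E)); exact: cvg_norm.
(* As [x n] lies in [C], the projection inequality gives [phi (x n) (z n) <= phi (x n) (Q n)], which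
   tends to 0. *)
have zp : z n @[n --> \oo] --> p.
  apply: (cvg_of_sub_cvg0 _ xp); apply: (phi_cvg0_sub E_smooth E_convex).
  apply: (squeeze_norm_cvg0 (b := fun n => phi (x n) (Q n))).
    apply: nearW => n; rewrite ger0_norm//.
    by have := (zP n).2 _ (Cx n); have := phi0 (z n) (Q n); lra.
  have -> : (0 : R) = phi p p by rewrite /phi duality_map_sq//; ring.
  exact: phi_limit.
have resolvent0 (s : nat -> E) : s n @[n --> \oo] --> p ->
    (r n)^-1 *: (duality_map (s n) - duality_map (y n)) @[n --> \oo]
      --> (0 : top_dual E).
  move=> sp; apply: (squeeze_norm_cvg0
    (b := fun n => c1^-1 * `|duality_map (s n) - duality_map (y n)|)).
    apply: nearW => n; rewrite normrZ ler_wpM2r//.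
    by rewrite gtr0_norm ?invr_gt0// lef_pV2 ?posrE.
  rewrite -(mulr0 c1^-1); apply: cvgMr; exact: Jsub.
exists p => //; split; [split|split].
(* Along the progression for [j], [T j (z _)] tends to [T j p] by continuity and to [p] by [Tzp];
   limits are unique. The zeros of [A i] follow the same pattern. *)
- move=> j _; split=> //.
  have [koo jE] := cyclic_subseq d_gt0 j.
  have zk := cvg_comp _ _ koo zp; have Tk := cvg_comp _ _ koo Tzp.
  have Cz k : C (z (k * d + j)%N) := (zP _).1.
  have := within_continuous_cvg (T_cont j) Cz Cp zk.
  move: Tk; rewrite /comp /Tz; under eq_fun do rewrite jE.
  by move=> Tk Tk'; exact: (cvg_unique (@norm_hausdorff _ E) Tk' Tk).
- move=> i _; split=> //.
  have [koo iE] := cyclic_subseq m_gt0 i.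
  have xk := cvg_comp _ _ koo xp; have Ak := cvg_comp _ _ koo Ax0.
  have /andP[gi0 _] := gamma_itv i.
  have Cxk k : C (x (k * m + i)%N) := Cx _.
  have := ism_continuous gi0 (A_ism i) Cxk Cp xk.
  move: Ak; rewrite /comp /Ax; under eq_fun do rewrite iE.
  by move=> Ak Ak'; exact: (cvg_unique (@norm_hausdorff _ (top_dual E)) Ak' Ak).
- exact: (GEP_limit C_convex f1_eq B1_cont Cp u_C up (resolvent0 u up) u_def).
- exact: (GEP_limit C_convex f2_eq B2_cont Cp v_C vp (resolvent0 v vp) v_def).
Unshelve. all: by end_near. Qed.
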